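(* Let $N\ge 1$ be an integer and let $a_1>a_2>\dots>a_N\ge-\infty$. Then the map $$(p_2,\dots,p_N)\mapsto C\Big(\sum_{i=1}^N p_i\delta_{a_i}\Big),\qquad p_1:=1-(p_2+\dots+p_N),$$ is analytic on $\{(p_2,\dots,p_N)\in[0,1]^{N-1} : 0\le p_2+\dots+p_N<1\}$.
   Context: $\delta_x$ is the Dirac measure at $x\in\{-\infty\}\cup\mathbb{R}$. For a probability distribution $\nu$ on $\{-\infty\}\cup\mathbb{R}$, let $(X_{i,j})_{0\le i<j}$ be i.i.d. random variables with distribution $\nu$, where $X_{i,j}$ is the weight of the directed edge $(i,j)$ of the complete directed acyclic graph on the non-negative integers. A directed path is a sequence of integers $\pi=(i_1,\dots,i_k)$ with $0\le i_1<\dots<i_k$; its weight is $w_\pi=X_{i_1,i_2}+\dots+X_{i_{k-1},i_k}$. Let $W_n=\max\{w_\pi : \pi=(i_1,\dots,i_k) \text{ a directed path with } i_1=0,\ i_k=n\}$. Then $W_n/n$ converges almost surely to a deterministic constant $C(\nu)\in\mathbb{R}\cup\{\pm\infty\}$, called the time constant for last passage percolation. A function on a (not necessarily open) set $D$ is analytic on $D$ if near each point of $D$ it coincides on $D$ with the sum of a (multivariate) power series converging in a neighbourhood of that point. *)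

(* Defs.v *)
From HB Require Import structures.
From mathcomp Require Import all_boot all_order all_algebra finmap.
From mathcomp Require Import all_classical all_reals all_analysis.
From mathcomp Require Import measurable_realfun.

Set Implicit Arguments.
Unset Strict Implicit.
Unset Printing Implicit Defensive.

Import Order.TTheory GRing.Theory Num.Theory.
Import numFieldNormedType.Exports.

Local Open Scope classical_set_scope.
Local Open Scope ring_scope.
Local Open Scope ereal_scope.

(* Laws on {-oo} `|` R are laws on \bar R giving no mass to +oo. *)

Definition mutually_independent (R : realType) (d d' : measure_display)
    (T : measurableType d) (T' : measurableType d') (P : probability T R)
    (I : choiceType) (D : set I) (X : I -> {RV P >-> T'}) : Prop :=
  forall (s : {fset I}) (B : I -> set T'),
    [set` s] `<=` D -> (forall i, measurable (B i)) ->
    P (\bigcap_(i in [set` s]) (X i @^-1` B i)) =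
      \prod_(i <- s) P (X i @^-1` B i).

Definition edges : set (nat * nat) := [set e | (e.1 < e.2)%N].

(* The values of X outside of edges are irrelevant. *)
Definition iid_weights (R : realType) (d : measure_display)
    (T : measurableType d) (P : probability T R)
    (nu : set (\bar R) -> \bar R) (X : nat * nat -> {RV P >-> \bar R}) : Prop :=
  mutually_independent edges X /\
  (forall e, edges e -> forall A, measurable A -> distribution P (X e) A = nu A).

(* A directed path is given by its first vertex i and the sequence s of its
   remaining vertices. *)
Definition path_weight (R : realType) (x : nat * nat -> \bar R)
    (i : nat) (s : seq nat) : \bar R :=
  \sum_(e <- zip (i :: s) s) x e.

Definition paths_to (n : nat) : set (seq nat) :=
  [set s | path ltn 0%N s /\ last 0%N s = n].

(* paths_to n is finite and nonempty, hence the supremum is a maximum. *)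
Definition last_passage (R : realType) (x : nat * nat -> \bar R) (n : nat) :
    \bar R :=
  ereal_sup [set path_weight x 0%N s | s in paths_to n].

Definition is_time_constant (R : realType) (nu : set (\bar R) -> \bar R)
    (c : \bar R) : Prop :=
  forall (d : measure_display) (T : measurableType d) (P : probability T R)
      (X : nat * nat -> {RV P >-> \bar R}),
    iid_weights nu X ->
    {ae P, forall w : T,
      (fun n : nat => last_passage (fun e => X e w) n * (n%:R^-1)%:E) @ \oo
        --> c}.

(* The value 0 is a default, used only if the limit does not exist. *)
Definition time_constant (R : realType) (nu : set (\bar R) -> \bar R) : \bar R :=
  xget 0 [set c | is_time_constant nu c].

(* p = (p_2, ..., p_N) with N = m.+1, and a = (a_1, ..., a_N): indices are
   shifted, so that p 0 j is the mass of a (lift ord0 j). *)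
Definition atomic_law (R : realType) (m : nat) (a : 'I_m.+1 -> \bar R)
    (p : 'rV[R]_m) : set (\bar R) -> \bar R :=
  fun A => (1 - \sum_j p ord0 j)%R%:E * \d_(a ord0) A +
           \sum_(j < m) (p ord0 j)%:E * \d_(a (lift ord0 j)) A.

Definition subsimplex (R : realType) (m : nat) : set 'rV[R]_m :=
  [set p | (forall j, 0 <= p ord0 j <= 1)%R /\ (0 <= \sum_j p ord0 j < 1)%R].

Definition monomial_term (R : realType) (m : nat) (c : {ffun 'I_m -> nat} -> R)
    (h : 'rV[R]_m) (k : {ffun 'I_m -> nat}) : R :=
  (c k * \prod_(i < m) h ord0 i ^+ k i)%R.

(* Convergence of a multivariate power series is absolute; its sum is then the
   limit of its partial sums over the boxes {0, ..., n-1}^m. *)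
Definition power_series_sums_to (R : realType) (m : nat)
    (c : {ffun 'I_m -> nat} -> R) (h : 'rV[R]_m) (l : R) : Prop :=
  summable setT (fun k => (monomial_term c h k)%:E) /\
  (fun n : nat => \sum_(k : {ffun 'I_m -> 'I_n})
     monomial_term c h [ffun i => k i : nat])%R @ \oo --> l.

(* In particular f is finite on D. *)
Definition analytic_on (R : realType) (m : nat) (D : set 'rV[R]_m)
    (f : 'rV[R]_m -> \bar R) : Prop :=
  forall x, D x -> exists c : {ffun 'I_m -> nat} -> R,
    \forall y \near x, exists2 l : R,
      power_series_sums_to c (y - x)%R l & (D y -> f y = l%:E).

(* Main.v *)
From HB Require Import structures.
Require Import Defs.
From mathcomp Require Import all_boot all_order all_algebra finmap.
From mathcomp Require Import all_classical all_reals all_analysis.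
From mathcomp Require Import measurable_realfun.
From mathcomp Require Import ring lra.

Set Implicit Arguments.
Unset Strict Implicit.
Unset Printing Implicit Defensive.

Import Order.TTheory GRing.Theory Num.Theory.
Import numFieldNormedType.Exports.

Local Open Scope classical_set_scope.
Local Open Scope ring_scope.

(** Let alpha = a_1, assumed finite.  If alpha <= 0, then W_n <= 0, while a path
    with two edges of weight alpha joins 0 to n for all large n, so the time
    constant is 0.

    Let alpha > 0.  Let M_n be the largest weight of a path in {0, ..., n}, with
    any endpoints; W_n differs from M_n by o(n), since the ends of an optimal
    path can be joined to 0 and n through vertices with two edges of weight
    alpha.  By exchangeability the edges into a new vertex may be revealed in
    decreasing order of the values of the earlier vertices, stopping at the
    first edge of weight alpha: the later ones are irrelevant.  The number k of
    edges revealed is geometric of parameter p_1.  If two configurations agree,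
    up to translation, in their r highest values and k <= max(r, 1), they agree
    in their r + 1 highest values after the step, and their maxima increase by
    the same amount; a Lyapunov function of r shows that the sequences of n
    steps ending with r = 0 have exponentially small mass.  This gives the
    exponential convergence of the mean increments of M_n to a limit C, and
    var M_n = O(n), hence M_n / n -> C almost surely by Borel-Cantelli along the
    squares.

    For analyticity, the same estimate is made on the l^1 norms of the
    coefficients of the mean increments, as polynomials in h = p - x on the
    polydisc of radius r: this only replaces the masses p_i by majorants whose
    sum exceeds 1 by O(r), which the exponential decay absorbs.  The increments
    thus form a series of polynomials with geometrically decreasing norms, whose
    sum is the required power series. *)

(** * Letter distributions *)

Section Letters.
Context {R : realType} {m : nat}.
Implicit Types (p b : 'I_m.+1 -> R) (g : seq 'I_m.+1 -> R).

(* A letter lists the indices of the weights of the edges into a new vertex, in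
   decreasing order of the values of their origins, up to the first index ord0
   (the largest weight) or up to length K. *)
Fixpoint letter_mean p (K : nat) g : R :=
  if K is K'.+1 then
    p ord0 * g [:: ord0] +
    \sum_(j < m) p (lift ord0 j) * letter_mean p K' (fun y => g (lift ord0 j :: y))
  else g [::].

Lemma eq_letter_mean p K g g' : g =1 g' -> letter_mean p K g = letter_mean p K g'.
Proof. by move=> e; congr letter_mean; apply/funext. Qed.

Lemma letter_meanD p K g g' :
  letter_mean p K (fun y => g y + g' y) = letter_mean p K g + letter_mean p K g'.
Proof.
elim: K g g' => //= K IH g g'; rewrite mulrDr -!addrA; congr (_ + _).
rewrite addrCA; congr (_ + _); rewrite -big_split /=.
by apply: eq_bigr => j _; rewrite IH mulrDr.
Qed.

Lemma letter_meanZ p K c g :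
  letter_mean p K (fun y => c * g y) = c * letter_mean p K g.
Proof.
elim: K g => //= K IH g; rewrite mulrDr mulrCA; congr (_ + _).
by rewrite mulr_sumr; apply: eq_bigr => j _; rewrite IH mulrCA.
Qed.

Lemma letter_meanB p K g g' :
  letter_mean p K (fun y => g y - g' y) = letter_mean p K g - letter_mean p K g'.
Proof.
rewrite -[in RHS](mulN1r (letter_mean p K g')) -letter_meanZ -letter_meanD.
by apply: eq_letter_mean => y; rewrite mulN1r.
Qed.

Lemma letter_mean_cst p K c :
  \sum_i p i = 1 -> letter_mean p K (fun=> c) = c.
Proof.
rewrite big_ord_recl => p1; elim: K => //= K IH.
under eq_bigr do rewrite IH.
by rewrite -mulr_suml -mulrDl p1 mul1r.
Qed.

Lemma ler_letter_mean p K g g' : (forall i, 0 <= p i) ->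
  (forall y, g y <= g' y) -> letter_mean p K g <= letter_mean p K g'.
Proof.
move=> p0; elim: K g g' => //= K IH g g' gg'.
by rewrite lerD// ?ler_wpM2l// ler_sum// => j _; rewrite ler_wpM2l// IH.
Qed.

Lemma letter_mean_ge0 p K g : (forall i, 0 <= p i) ->
  (forall y, 0 <= g y) -> 0 <= letter_mean p K g.
Proof.
move=> p0 g0; elim: K g g0 => //= K IH g g0.
by rewrite addr_ge0 ?mulr_ge0// sumr_ge0// => j _; rewrite mulr_ge0// IH.
Qed.

Definition hits_within (r : nat) (y : seq 'I_m.+1) : bool :=
  (ord0 \in y) && (size y <= r)%N.

Arguments hits_within : simpl never.

(* The number of top ranks known to agree up to translation in two coupled
   configurations, after both have read the letter y. *)
Definition renew (r : nat) (y : seq 'I_m.+1) : nat :=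
  if hits_within (maxn r 1) y then r.+1 else 0%N.

Lemma hits_within_top r : (0 < r)%N -> hits_within r [:: ord0].
Proof. by rewrite /hits_within inE eqxx. Qed.

Variables (b : 'I_m.+1 -> R) (lam : R).
Hypotheses (b_ge0 : forall i, 0 <= b i) (lam_ge1 : 1 <= lam).
Let Q : R := \sum_(j < m) b (lift ord0 j).
Hypothesis lam_fix : b ord0 + Q * lam <= lam.

(** The total mass is 1 at [K = 0] and evolves by [u -> b ord0 + Q * u], of which [lam] is a
    supersolution. The masses [b] are majorants and may sum to more than 1. *)
Lemma letter_mean1_le K : letter_mean b K (fun=> 1) <= lam.
Proof.
elim: K => //= K IH; rewrite mulr1 -mulr_suml (le_trans _ lam_fix)//.
by rewrite lerD2l ler_wpM2l// sumr_ge0.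
Qed.

(** A letter that misses starts with [r] indices other than [ord0], of mass [Q ^+ r]; its
    continuations have mass at most [lam]. *)
Lemma letter_mean_tail_le K r : (r <= K)%N ->
  letter_mean b K (fun y => (~~ hits_within r y)%:R) <= lam * Q ^+ r.
Proof.
elim: r K => [|r IH] K.
  move=> _; rewrite mulr1 (le_trans _ (letter_mean1_le K))//.
  by apply: ler_letter_mean => // y; case: (~~ _) => //=.
case: K => //= K rK.
rewrite mulr0 add0r exprS mulrCA.
rewrite [Q * _]mulr_suml; apply: ler_sum => j _; rewrite ler_wpM2l//.
by apply: le_trans (IH _ rK); apply: ler_letter_mean.
Qed.

Lemma letter_mean_hits_ge K r : (0 < K)%N -> (0 < r)%N ->
  b ord0 <= letter_mean b K (fun y => (hits_within r y)%:R).
Proof.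
case: K => // K _ r0 /=.
rewrite hits_within_top// mulr1 lerDl sumr_ge0// => j _.
by rewrite mulr_ge0// letter_mean_ge0.
Qed.

End Letters.

(** * A Lyapunov function for the agreement rank *)

Section Drift.
Context {R : realType}.

Lemma exists_expr_le (x e : R) : 0 <= x < 1 -> 0 < e -> exists n : nat, x ^+ n <= e.
Proof.
move=> /andP[x0 x1] e0.
have xlt : `|x| < 1 by rewrite ger0_norm.
have := cvg_expr xlt.
move/cvgrPdist_le => /(_ e e0) [n _ /(_ n (leqnn n))] /=.
by rewrite sub0r normrN ger0_norm ?exprn_ge0// => ?; exists n.
Qed.

(** One letter contracts the mean of [phi] at the new agreement rank, uniformly in [K] and [r]. The
    slack [delta] lets the mass bound [lam] exceed 1, as happens for majorants on a polydisc. *)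
Lemma drift_function (m : nat) (P Qb : R) :
  0 < P -> P <= 1 -> 0 <= Qb -> Qb < 1 ->
  exists (phi : nat -> R) (rho delta : R),
  [/\ 0 < rho < 1, 0 < delta, phi 0%N = 1, forall r, 0 <= phi r <= 1 &
   forall (b : 'I_m.+1 -> R) (lam : R) K r, (forall i, 0 <= b i) ->
     P <= b ord0 -> \sum_(j < m) b (lift ord0 j) <= Qb ->
     1 <= lam -> lam <= 1 + delta ->
     b ord0 + (\sum_(j < m) b (lift ord0 j)) * lam <= lam ->
     (r < K)%N ->
     letter_mean b K (fun y => phi (renew r y)) <= rho * phi r].
Proof.
move=> P_gt0 P_le1 Qb_ge0 Qb_lt1.
(* phi decreases slowly from 1 to at least 1/2 on [0, R0], where each step has
   probability at least P to increase r, then geometrically beyond R0, where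
   the probability Qb ^ r of a return to 0 is negligible. *)
pose x : R := Num.max Qb 2^-1.
have x_gt0 : 0 < x by rewrite lt_max invr_gt0 ltr0n orbT.
have x_lt1 : x < 1 by rewrite gt_max Qb_lt1 invf_lt1// ltr1n.
have Qbx : Qb <= x by rewrite le_max lexx.
have [R1 HR1] : exists n : nat, Qb ^+ n <= (1 - x) / 16.
  by apply: exists_expr_le; [rewrite Qb_ge0|lra].
(* The successor makes all ranks from [R0] on positive, so that [maxn r 1 = r] there. *)
pose R0 := R1.+1.
have HR0 : Qb ^+ R0 <= (1 - x) / 16.
  rewrite exprS (le_trans _ HR1)// ler_piMl ?exprn_ge0//; exact: ltW.
pose B : R := (2 / P) ^+ R0.
have B1 : 1 <= 2 / P by rewrite ler_pdivlMr//; lra.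
have B_ge1 : 1 <= B by exact: exprn_ege1.
(* Normalizes [psi R0] to at most 1/2. The ratio [2 / P] in [psi] makes [P * psi r.+1] exceed
   [psi r] by a fixed margin. *)
pose c : R := (2 * B)^-1.
have c_gt0 : 0 < c by rewrite invr_gt0; lra.
have B_neq0 : B != 0 by rewrite gt_eqF// (lt_le_trans ltr01).
have cB : c * B = 2^-1 by rewrite /c invfM mulfVK.
have c_le : c <= 2^-1 by rewrite -cB ler_peMr// ltW.
pose psi (r : nat) : R := c * ((2 / P) ^+ r - 1).
have psi_ge0 r : 0 <= psi r.
  by rewrite mulr_ge0 ?(ltW c_gt0)// subr_ge0 exprn_ege1.
have psi_le r : (r <= R0)%N -> psi r <= 2^-1.
  move=> rR; rewrite -cB ler_pM2l// lerBlDr (le_trans (_ : _ <= B))//; last by lra.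
  by rewrite ler_weXn2l.
pose phi (r : nat) : R :=
  if (r <= R0)%N then 1 - psi r else (1 - psi R0) * x ^+ (r - R0).
have phi01 r : 0 <= phi r <= 1.
  rewrite /phi; case: leqP => rR.
    have := psi_ge0 r; have := psi_le _ rR; lra.
  have p1 := psi_ge0 R0; have p2 := psi_le _ (leqnn R0).
  have x0 : 0 <= x ^+ (r - R0) by rewrite exprn_ge0// ltW.
  have x1 : x ^+ (r - R0) <= 1 by rewrite exprn_ile1 ?ltW.
  by apply/andP; split; [apply: mulr_ge0; lra|apply: mulr_ile1 => //; lra].
pose rho : R := Num.max (1 - c / 2) ((1 + x) / 2).
pose delta : R := Num.min (c / 2) ((1 - x) / 4).
have rho_lt1 : rho < 1 by rewrite gt_max; apply/andP; split; lra.
have rho1 : 1 - c / 2 <= rho by rewrite le_max lexx.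
have rho2 : (1 + x) / 2 <= rho by rewrite le_max lexx orbT.
have delta1 : delta <= c / 2 by rewrite ge_min lexx.
have delta2 : delta <= (1 - x) / 4 by rewrite ge_min lexx orbT.
exists phi, rho, delta; split=> //.
- by rewrite rho_lt1 andbT; lra.
- by rewrite lt_min; apply/andP; split; lra.
- by rewrite /phi /= /psi expr0; lra.
move=> b lam K r b0 Pb bQ lam1 lamd lamfix rK.
have K0 : (0 < K)%N by exact: leq_ltn_trans rK.
have Q0 : 0 <= \sum_(j < m) b (lift ord0 j) by exact: sumr_ge0.
set head := letter_mean b K (fun y => (hits_within (maxn r 1) y)%:R).
set tail := letter_mean b K (fun y => (~~ hits_within (maxn r 1) y)%:R).
have headP : P <= head.
  by rewrite (le_trans Pb)// letter_mean_hits_ge// leq_max orbT.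
have tail0 : 0 <= tail by apply: letter_mean_ge0 => // y; exact: ler0n.
have ht : head + tail <= lam.
  rewrite -letter_meanD (le_trans _ (letter_mean1_le b0 lam1 lamfix K))//.
  by apply: ler_letter_mean => // y; case: hits_within; rewrite /= ?addr0 ?add0r.
(* As [phi 0 = 1], a miss contributes its full mass. *)
have -> : letter_mean b K (fun y => phi (renew r y)) = phi r.+1 * head + tail.
  rewrite -letter_meanZ -letter_meanD; apply: eq_letter_mean => y.
  rewrite /renew; case: hits_within; rewrite /= ?mulr1 ?addr0// mulr0 add0r.
  by rewrite /phi /= /psi expr0; lra.
(* Below [R0], [psiS] yields a gain of at least [c], of which the excess mass [delta] takes at most
   [c / 2]. *)
case: (ltnP r R0) => rR.
  have rR' : (r <= R0)%N := ltnW rR.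
  rewrite /phi rR rR'.
  have psiS : P * psi r.+1 = 2 * psi r + c * (2 - P).
    rewrite /psi exprS; field; lra.
  have h1 : psi r.+1 * P <= psi r.+1 * head by rewrite ler_wpM2l.
  have h2 : 0 <= c * (1 - P) by rewrite mulr_ge0//; lra.
  have h3 : rho * (1 - psi r) >= (1 - c / 2) * (1 - psi r).
    by rewrite ler_wpM2r//; have := psi_le _ rR'; lra.
  have h4 := psi_ge0 r.
  have h5 : 0 <= c * psi r by rewrite mulr_ge0// ltW.
  rewrite (le_trans _ h3)//.
  have -> : (1 - psi r.+1) * head + tail = head + tail - psi r.+1 * head by ring.
  lra.
(* From [R0] on, a hit contracts [phi] by [x], and a miss has mass of order [Qb ^+ r], small against
   [x ^+ (r - R0)] by the choice of [R0]. *)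
have r0 : (0 < r)%N by exact: leq_trans rR.
have tailr : tail <= lam * Qb ^+ r.
  rewrite /tail (maxn_idPl r0).
  apply: le_trans (letter_mean_tail_le b0 lam1 lamfix (ltnW rK)) _.
  by rewrite ler_wpM2l ?(le_trans ler01)// lerXn2r// nnegrE.
have phiE s : (R0 <= s)%N -> phi s = (1 - psi R0) * x ^+ (s - R0).
  rewrite leq_eqVlt => /orP[/eqP <-|sR]; first by rewrite /phi leqnn subnn expr0 mulr1.
  by rewrite /phi leqNgt sR.
rewrite !phiE// ?(leq_trans rR)// subSn// exprS.
set y := x ^+ (r - R0).
have y0 : 0 < y by rewrite exprn_gt0.
have Qr : Qb ^+ r <= (1 - x) / 16 * y.
  rewrite -(subnKC rR) exprD ler_pM ?exprn_ge0//.
  by rewrite lerXn2r// nnegrE// ltW.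
have f1 := psi_le _ (leqnn R0).
set f := 1 - psi R0; have f2 : 2^-1 <= f by rewrite /f; lra.
have f3 : f <= 1 by rewrite /f; have := psi_ge0 R0; lra.
have fy0 : 0 <= f * y by apply: mulr_ge0; lra.
have g1 : f * (x * y) * head <= lam * (f * (x * y)).
  have fxy0 : 0 <= f * (x * y) by rewrite mulrCA mulr_ge0// ltW.
  by rewrite mulrC ler_wpM2r//; lra.
have g2 : lam * Qb ^+ r <= 2 * ((1 - x) / 16 * y).
  rewrite ler_pM ?exprn_ge0//; lra.
have g3 : (1 + x) / 2 * (f * y) <= rho * (f * y).
  by rewrite ler_wpM2r.
rewrite (le_trans _ g3)//.
have g4 : (lam * x) * (f * y) <= (x + (1 - x) / 4) * (f * y).
  rewrite ler_wpM2r//.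
  have : lam * x <= (1 + delta) * x by rewrite ler_wpM2r// ltW.
  have : delta * x <= delta by rewrite ler_piMr// ltW// lt_min; apply/andP; split; lra.
  lra.
have g5 : (1 - x) * (2^-1 * y) <= (1 - x) * (f * y).
  by rewrite ler_pM2l ?subr_gt0// ler_wpM2r// ltW.
have -> : f * (x * y) = x * (f * y) by ring.
have -> : x * (f * y) * head = head * (x * (f * y)) by ring.
have g6 : head * (x * (f * y)) <= lam * x * (f * y).
  have -> : head * (x * (f * y)) = f * (x * y) * head by ring.
  by have -> : lam * x * (f * y) = lam * (f * (x * y)) by ring.
lra.
Qed.

End Drift.

(** * Polynomials and power series in several variables *)

Section PolynomialMajorants.
Context {R : realType} {m : nat}.
Implicit Types (f g : 'rV[R]_m -> R) (l : seq (R * {ffun 'I_m -> nat})).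

(** Exponents may repeat in the list of terms, so that sums and products need no collection of equal
    monomials. *)
Definition monomials_sum l (h : 'rV[R]_m) : R :=
  \sum_(t <- l) t.1 * \prod_i h ord0 i ^+ t.2 i.

(** An l^1 norm of the listed coefficients, weighted by [r] to the degree: it is submultiplicative
    and bounds the polynomial on the polydisc of radius [r]. *)
Definition monomials_norm (r : R) l : R :=
  \sum_(t <- l) `|t.1| * r ^+ (\sum_i t.2 i)%N.

Definition poly_bounded (r : R) f (B : R) : Prop :=
  exists2 l, f = monomials_sum l & monomials_norm r l <= B.

Variables (r : R).
Hypothesis r_ge0 : 0 <= r.

Lemma poly_bounded_le f B B' : poly_bounded r f B -> B <= B' -> poly_bounded r f B'.
Proof. by case=> l -> lB BB'; exists l => //; exact: le_trans BB'. Qed.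

Lemma poly_bounded_cst c : poly_bounded r (fun=> c) `|c|.
Proof.
exists [:: (c, [ffun=> 0%N])].
  apply/funext => h; rewrite /monomials_sum big_seq1 /= big1 ?mulr1// => i _.
  by rewrite ffunE expr0.
rewrite /monomials_norm big_seq1 /= big1 ?expr0 ?mulr1// => i _.
by rewrite ffunE.
Qed.

Lemma poly_bounded_coord j : poly_bounded r (fun h => h ord0 j) r.
Proof.
exists [:: (1, [ffun i => (i == j : nat)])].
  apply/funext => h; rewrite /monomials_sum big_seq1 /= (bigD1 j)//= ffunE eqxx.
  rewrite big1 ?mulr1 ?mul1r// => i ij; by rewrite ffunE (negbTE ij) expr0.
rewrite /monomials_norm big_seq1 /= (bigD1 j)//= ffunE eqxx big1.
  by rewrite normr1 mul1r addn0 expr1.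
by move=> i ij; rewrite ffunE (negbTE ij).
Qed.

Lemma poly_boundedD f g B C : poly_bounded r f B -> poly_bounded r g C ->
  poly_bounded r (fun h => f h + g h) (B + C).
Proof.
move=> [l -> lB] [l' -> lC]; exists (l ++ l').
  by apply/funext => h; rewrite /monomials_sum big_cat.
by rewrite /monomials_norm big_cat lerD.
Qed.

Lemma poly_boundedM f g B C : poly_bounded r f B -> poly_bounded r g C ->
  poly_bounded r (fun h => f h * g h) (B * C).
Proof.
move=> [l -> lB] [l' -> lC].
pose mul (t t' : R * {ffun 'I_m -> nat}) : R * {ffun 'I_m -> nat} :=
  (t.1 * t'.1, [ffun i => (t.2 i + t'.2 i)%N]).
exists [seq mul t t' | t <- l, t' <- l'].
  apply/funext => h; rewrite /monomials_sum big_allpairs_dep /= mulr_suml.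
  apply: eq_bigr => t _; rewrite mulr_sumr; apply: eq_bigr => t' _ /=.
  rewrite mulrACA -big_split /=; congr (_ * _).
  by apply: eq_bigr => i _; rewrite ffunE exprD.
apply: (@le_trans _ _ (monomials_norm r l * monomials_norm r l')).
  rewrite /monomials_norm big_allpairs_dep /= mulr_suml le_eqVlt; apply/orP; left.
  apply/eqP/eq_bigr => t _; rewrite mulr_sumr; apply: eq_bigr => t' _ /=.
  rewrite mulrACA -exprD normrM -big_split /=; congr (_ * _ ^+ _).
  by apply: eq_bigr => i _; rewrite ffunE.
have norm_ge0 l0 : 0 <= monomials_norm r l0.
  by apply: sumr_ge0 => t _; rewrite mulr_ge0// exprn_ge0.
exact: ler_pM.
Qed.

Lemma poly_boundedZ c f B : poly_bounded r f B ->
  poly_bounded r (fun h => c * f h) (`|c| * B).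
Proof. by move=> fB; apply: poly_boundedM => //; exact: poly_bounded_cst. Qed.

Lemma poly_boundedB f g B C : poly_bounded r f B -> poly_bounded r g C ->
  poly_bounded r (fun h => f h - g h) (B + C).
Proof.
move=> fB gC; have -> : (fun h => f h - g h) = (fun h => f h + (-1) * g h).
  by apply/funext => h; rewrite mulN1r.
by apply: poly_boundedD => //; have := poly_boundedZ (-1) gC; rewrite normrN1 mul1r.
Qed.

Lemma poly_bounded_sum (I : Type) (s : seq I) (f : I -> 'rV[R]_m -> R) (B : I -> R) :
  (forall i, poly_bounded r (f i) (B i)) ->
  poly_bounded r (fun h => \sum_(i <- s) f i h) (\sum_(i <- s) B i).
Proof.
move=> fB; elim: s => [|i s IH].
  have := poly_bounded_cst 0; rewrite normr0 big_nil.
  by congr poly_bounded; apply/funext => h; rewrite big_nil.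
rewrite big_cons; have := poly_boundedD (fB i) IH.
by congr poly_bounded; apply/funext => h; rewrite big_cons.
Qed.

(** [letter_mean] is a polynomial with nonnegative coefficients in the masses and in the values of
    the function, so majorants may be substituted for both. *)
Lemma poly_bounded_letter_mean (M : nat) (p : 'I_M.+1 -> 'rV[R]_m -> R)
    (b : 'I_M.+1 -> R) K (g : seq 'I_M.+1 -> 'rV[R]_m -> R) (G : seq 'I_M.+1 -> R) :
  (forall i, poly_bounded r (p i) (b i)) ->
  (forall y, poly_bounded r (g y) (G y)) ->
  poly_bounded r (fun h => letter_mean (p^~ h) K (g^~ h)) (letter_mean b K G).
Proof.
move=> pb; elim: K g G => [|K IH] g G gG /=; first exact: gG.
apply: poly_boundedD; first exact: poly_boundedM.
apply: poly_bounded_sum => j; apply: poly_boundedM => //.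
by apply: (IH (fun y h => g (lift ord0 j :: y) h)) => y; exact: gG.
Qed.

Lemma monomials_term_le (a : R) (k : {ffun 'I_m -> nat}) (h : 'rV[R]_m) :
  (forall i, `|h ord0 i| <= r) ->
  `|a * \prod_i h ord0 i ^+ k i| <= `|a| * r ^+ (\sum_i k i)%N.
Proof.
move=> hr; rewrite normrM ler_wpM2l// normr_prod.
apply: (@le_trans _ _ (\prod_i r ^+ k i)); last by rewrite prodrXr.
by apply: ler_prod => i _; rewrite normr_ge0 normrX lerXn2r ?nnegrE.
Qed.

Lemma poly_bounded_norm f B (h : 'rV[R]_m) : poly_bounded r f B ->
  (forall i, `|h ord0 i| <= r) -> `|f h| <= B.
Proof.
case=> l -> lB hr; apply: le_trans lB; apply: le_trans (ler_norm_sum _ _ _) _.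
by apply: ler_sum => t _; exact: monomials_term_le.
Qed.

End PolynomialMajorants.

(** * Sums over boxes of exponents *)

Section PowerSeries.
Context {R : realType} {m : nat}.
Implicit Types (h : 'rV[R]_m) (c : {ffun 'I_m -> nat} -> R).

Definition box_sum n (u : {ffun 'I_m -> nat} -> R) : R :=
  \sum_(k : {ffun 'I_m -> 'I_n}) u [ffun i => k i : nat].

Lemma box_index n (k : {ffun 'I_m -> nat}) : (forall i, k i < n)%N ->
  {j : {ffun 'I_m -> 'I_n} | k = [ffun i => j i : nat]}.
Proof.
by move=> kn; exists [ffun i => Ordinal (kn i)]; apply/ffunP => i; rewrite !ffunE.
Qed.

Lemma box_embed_inj n :
  injective (fun k : {ffun 'I_m -> 'I_n} => [ffun i => k i : nat]).
Proof.
move=> j k /ffunP jk; apply/ffunP => i; apply/val_inj.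
by have := jk i; rewrite !ffunE.
Qed.

Lemma box_sum_ge_seq (s : seq {ffun 'I_m -> nat}) (u : {ffun 'I_m -> nat} -> R) :
  uniq s -> (forall k, 0 <= u k) -> exists n, \sum_(k <- s) u k <= box_sum n u.
Proof.
move=> s_uniq u0; pose n := (\max_(k <- s) \max_i k i).+1.
have kn (k : {ffun 'I_m -> nat}) : k \in s -> forall i, (k i < n)%N.
  move=> ks i; rewrite ltnS (leq_trans (leq_bigmax i))//.
  exact: (@leq_bigmax_seq _ _ xpredT (fun k : {ffun 'I_m -> nat} => \max_i k i)).
pose e (k : {ffun 'I_m -> 'I_n}) : {ffun 'I_m -> nat} := [ffun i => k i : nat].
pose g (k : {ffun 'I_m -> nat}) : {ffun 'I_m -> 'I_n} := [ffun i => inord (k i)].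
have gK k : k \in s -> e (g k) = k.
  by move=> ks; apply/ffunP => i; rewrite !ffunE inordK// kn.
exists n; have -> : \sum_(k <- s) u k = \sum_(k <- map g s) u (e k).
  by rewrite big_map big_seq [RHS]big_seq; apply: eq_bigr => k /gK ->.
rewrite big_uniq /=; last first.
  rewrite map_inj_in_uniq// => j k js ks jk.
  by rewrite -(gK _ js) -(gK _ ks) jk.
rewrite /box_sum [leRHS](bigID (mem (map g s)))/= lerDl.
by apply: sumr_ge0.
Qed.

(** Summability is tested on finite sets of exponents, and each of them lies in a box. *)
Lemma box_bounded_summable (u : {ffun 'I_m -> nat} -> R) (B : R) :
  (forall n, box_sum n (fun k => `|u k|) <= B) ->
  summable setT (fun k => (u k)%:E).
Proof.
move=> uB; rewrite /summable (@le_lt_trans _ _ B%:E) ?ltry//.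
apply: ge_ereal_sup => _ [A [finA _] <-].
rewrite fsbig_finite//=.
rewrite sumEFin lee_fin.
have [n] := @box_sum_ge_seq (fset_set A) (fun k => `|u k|)
  (fset_uniq _) (fun k => normr_ge0 _).
by move/le_trans; exact.
Qed.

Definition monomials_coef (l : seq (R * {ffun 'I_m -> nat})) k : R :=
  \sum_(t <- l | t.2 == k) t.1.

(** Collecting equal exponents can only lower the norm, and each listed term is counted at most once
    in the box. *)
Lemma box_sum_monomials_norm l n (r : R) : 0 <= r ->
  box_sum n (fun k => `|monomials_coef l k| * r ^+ (\sum_i k i)%N)
    <= monomials_norm r l.
Proof.
move=> r0; rewrite /box_sum.
apply: (@le_trans _ _ (\sum_(k : {ffun 'I_m -> 'I_n})
   \sum_(t <- l | t.2 == [ffun i => k i : nat]) `|t.1| * r ^+ (\sum_i t.2 i)%N)).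
  apply: ler_sum => k _; set k' := [ffun i => k i : nat].
  apply: (@le_trans _ _ ((\sum_(t <- l | t.2 == k') `|t.1|) *
     r ^+ (\sum_i k' i)%N)).
    by rewrite ler_wpM2r ?exprn_ge0// /monomials_coef ler_norm_sum.
  by rewrite mulr_suml ler_sum// => t /eqP ->.
under eq_bigr do rewrite big_mkcond.
rewrite exchange_big /=; apply: ler_sum => t _.
have t0 : 0 <= `|t.1| * r ^+ (\sum_i t.2 i)%N by rewrite mulr_ge0// exprn_ge0.
rewrite -big_mkcond /=.
case: (pselect (exists k : {ffun 'I_m -> 'I_n}, t.2 = [ffun i => k i : nat])).
  move=> [k kE]; rewrite (big_pred1 k)// => j.
  by rewrite kE (inj_eq (@box_embed_inj n)) eq_sym.
move=> nk; rewrite big_pred0// => k; apply/negP => /eqP tk.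
by apply: nk; exists k.
Qed.

(** The equality is exact once the box contains all exponents of [l], a threshold independent of
    [h]. *)
Lemma box_sum_monomials l : \forall n \near \oo, forall h,
  box_sum n (monomial_term (monomials_coef l) h) = monomials_sum l h.
Proof.
exists (\max_(t <- l) \max_i t.2 i).+1 => //= n /= ln h.
rewrite /box_sum /monomial_term /monomials_coef.
under eq_bigr do rewrite big_mkcond mulr_suml.
rewrite exchange_big /=; rewrite /monomials_sum big_seq [RHS]big_seq.
apply: eq_bigr => t tl.
have tn i : (t.2 i < n)%N.
  rewrite (leq_trans _ ln)// ltnS (leq_trans (leq_bigmax i))//.
  exact: (@leq_bigmax_seq _ _ xpredT
    (fun t : R * {ffun 'I_m -> nat} => \max_i t.2 i)).
have [k kE] := box_index tn.
rewrite (bigD1 k)//= kE eqxx [X in _ + X]big1 ?addr0//.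
move=> j jk; rewrite (inj_eq (@box_embed_inj n)) eq_sym (negbTE jk).
by rewrite mul0r.
Qed.

Lemma box_sum_monomial_term_le c n h (r : R) : 0 <= r -> (forall i, `|h ord0 i| <= r) ->
  box_sum n (fun k => `|monomial_term c h k|) <=
  box_sum n (fun k => `|c k| * r ^+ (\sum_i k i)%N).
Proof. by move=> r0 hr; apply: ler_sum => k _; exact: monomials_term_le. Qed.

End PowerSeries.

(** * Geometrically dominated series *)

Section GeometricConvergence.
Context {R : realType}.

Lemma geometric_tail_le (A rho : R) n p : 0 <= A -> 0 <= rho < 1 ->
  \sum_(n <= i < p) A * rho ^+ i <= A * rho ^+ n / (1 - rho).
Proof.
move=> A0 /andP[rho0 rho1].
have r0 : 0 < 1 - rho by rewrite subr_gt0.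
case: (leqP n p) => np; last first.
  by rewrite (big_geq (ltnW np)) !mulr_ge0 ?exprn_ge0// invr_ge0 ltW.
rewrite ler_pdivlMr//.
suff -> : (\sum_(n <= i < p) A * rho ^+ i) * (1 - rho) = A * rho ^+ n - A * rho ^+ p.
  by rewrite gerBl mulr_ge0// exprn_ge0.
have E i : A * rho ^+ i * (1 - rho) = - (A * rho ^+ i.+1 - A * rho ^+ i).
  by rewrite exprS; ring.
rewrite mulr_suml; under eq_bigr do rewrite E.
by rewrite sumrN telescope_sumr// opprB.
Qed.

Lemma series_dist_geometric (u : R ^nat) (A rho : R) n p :
  0 <= A -> 0 <= rho < 1 -> (forall i, `|u i| <= A * rho ^+ i) -> (n <= p)%N ->
  `|series u p - series u n| <= A * rho ^+ n / (1 - rho).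
Proof.
move=> A0 rho01 uA np; rewrite sub_series_geq//.
apply: le_trans (ler_norm_sum _ _ _) _.
apply: le_trans (geometric_tail_le n p A0 rho01).
by apply: ler_sum.
Qed.

Lemma series_cvg_geometric (u : R ^nat) (A rho : R) : 0 <= A -> 0 <= rho < 1 ->
  (forall i, `|u i| <= A * rho ^+ i) ->
  exists2 l, series u @ \oo --> l &
    forall n, `|l - series u n| <= A * rho ^+ n / (1 - rho).
Proof.
move=> A0 rho01 uA; have /andP[rho0 rho1] := rho01.
have cu : cvgn (series u).
  apply: normed_cvg; apply: (@series_le_cvg _ _ (geometric A rho)) => //.
  - by move=> n; exact: normr_ge0.
  - by move=> n; rewrite /geometric /= mulr_ge0 ?exprn_ge0.
  - by apply: is_cvg_geometric_series; rewrite ger0_norm.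
exists (limn (series u)) => // n.
have : `|series u p - series u n| @[p --> \oo] --> `|limn (series u) - series u n|.
  by apply: cvg_norm; apply: cvgB => //; exact: cvg_cst.
move/cvgr_to_le; apply; exists n => //= p np.
exact: (@series_dist_geometric u A rho).
Qed.

End GeometricConvergence.

(** * Sums of polynomials with geometrically decreasing norms *)

Section PowerSeriesSum.
Context {R : realType} {m : nat}.
Variables (r A rho : R) (f : nat -> 'rV[R]_m -> R).
Hypotheses (r_gt0 : 0 < r) (A_ge0 : 0 <= A) (rho01 : 0 <= rho < 1).
Hypothesis f_bounded : forall n, poly_bounded r (f n) (A * rho ^+ n).

(** The coefficient of each monomial is summed over [n]; the weighted l^1 bounds allow the two
    summations to be exchanged. *)
Lemma power_series_of_poly_bounded : exists c, forall h : 'rV[R]_m,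
  (forall i, `|h ord0 i| <= r) ->
  exists2 l, power_series_sums_to c h l & series (f^~ h) @ \oo --> l.
Proof.
have r_ge0 := ltW r_gt0.
have /choice[l /all_and2[fl lA]] n : exists l, f n = monomials_sum l /\
    monomials_norm r l <= A * rho ^+ n.
  by have [l ? ?] := f_bounded n; exists l.
pose w (k : {ffun 'I_m -> nat}) := r ^+ (\sum_i k i)%N.
have w_gt0 k : 0 < w k by exact: exprn_gt0.
pose a n k := monomials_coef (l n) k.
have aA n k : `|a n k| * w k <= A * rho ^+ n.
  apply: le_trans (lA n); apply: le_trans (box_sum_monomials_norm (l n) (\max_i k i).+1 r_ge0).
  have kn i : (k i < (\max_i k i).+1)%N by rewrite ltnS leq_bigmax.
  have [j kE] := box_index kn.
  rewrite /box_sum (bigD1 j)//= -kE lerDl.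
  by apply: sumr_ge0 => i _; rewrite mulr_ge0// exprn_ge0.
have cex k : exists c : R, series (a^~ k) @ \oo --> c.
  have aw n : `|a n k| <= A / w k * rho ^+ n by rewrite mulrAC ler_pdivlMr.
  have [c cc _] := series_cvg_geometric (divr_ge0 A_ge0 (ltW (w_gt0 k))) rho01 aw.
  by exists c.
have [c cP] := choice cex.
(* Finite box sums pass to the limit in [p], with a bound uniform in [N]. At [n = 0] this gives
   summability, for large [n] it controls the remainder. *)
have tail n N : box_sum N (fun k => `|c k - series (a^~ k) n| * w k)
    <= A * rho ^+ n / (1 - rho).
  have : box_sum N (fun k => `|series (a^~ k) p - series (a^~ k) n| * w k)
      @[p --> \oo] --> box_sum N (fun k => `|c k - series (a^~ k) n| * w k).
    apply: cvg_big => [|k _]; first by move=> x; exact: add_continuous.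
    apply: cvgMl; apply: cvg_norm; apply: cvgB; last exact: cvg_cst.
    exact: cP.
  move/cvgr_to_le; apply; exists n => //= p np.
  apply: le_trans (geometric_tail_le n p A_ge0 rho01).
  apply: (@le_trans _ _ (\sum_(n <= i < p) box_sum N (fun k => `|a i k| * w k))).
    rewrite /box_sum exchange_big /=; apply: ler_sum => k _.
    by rewrite -mulr_suml ler_wpM2r ?(ltW (w_gt0 _))// sub_series_geq// ler_norm_sum.
  by apply: ler_sum => i _; apply: le_trans (lA i); exact: box_sum_monomials_norm.
pose flat n := flatten [seq l i | i <- index_iota 0 n].
have flat_coef n k : monomials_coef (flat n) k = series (a^~ k) n.
  by rewrite /monomials_coef big_flatten /= big_map.
have flat_sum n h : monomials_sum (flat n) h = series (f^~ h) n.
  rewrite /monomials_sum big_flatten /= big_map; apply: eq_bigr => i _.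
  by rewrite fl.
exists c => h hr.
have [L fL LB] := @series_cvg_geometric _ (f^~ h) A rho A_ge0 rho01
  (fun n => poly_bounded_norm r_ge0 (f_bounded n) hr).
exists L => //; split.
  apply: (@box_bounded_summable _ _ _ (A / (1 - rho))) => N.
  apply: le_trans (box_sum_monomial_term_le c N r_ge0 hr) _.
  have := tail 0%N N; rewrite expr0 mulr1; apply: le_trans.
  by apply: ler_sum => k _; rewrite seriesEnat /= big_geq// subr0.
apply/cvgrPdist_le => e e0.
have /andP[rho0 rho1] := rho01.
have [n An] : exists n, A * rho ^+ n / (1 - rho) <= e / 2.
  have A1 : 0 < A + 1 by rewrite ltr_wpDl.
  have d0 : 0 < e / 2 * (1 - rho) / (A + 1).
    by rewrite !mulr_gt0 ?invr_gt0 ?subr_gt0.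
  have [n rn] := exists_expr_le rho01 d0.
  exists n; rewrite ler_pdivrMr ?subr_gt0//.
  move: rn; rewrite ler_pdivlMr//; apply: le_trans.
  by rewrite mulrC ler_wpM2l ?exprn_ge0// lerDl.
near=> N.
(* A large box recovers the partial sum up to [n] exactly. What remains is a tail of the series of
   functions and a tail of the coefficients, each at most [e / 2]. *)
have -> : L - box_sum N (monomial_term c h) =
    (L - series (f^~ h) n) -
      box_sum N (fun k => monomial_term (fun k => c k - series (a^~ k) n) h k).
  rewrite -flat_sum -(near (box_sum_monomials (flat n)) N)// -addrA -opprD.
  congr (_ - _); rewrite /box_sum -big_split /=; apply: eq_bigr => k _.
  by rewrite /monomial_term flat_coef mulrBl addrC subrK.
apply: le_trans (ler_normB _ _) _.
rewrite (splitr e) lerD//; first exact: le_trans (LB n) An.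
apply: le_trans An; apply: le_trans (tail n N).
apply: le_trans (box_sum_monomial_term_le _ N r_ge0 hr).
exact: ler_norm_sum.
Unshelve. all: by end_near. Qed.

End PowerSeriesSum.

(** * The chain of ranked values *)

Section Fronts.
Context {R : realType} {m : nat}.
Variable a : 'I_m.+1 -> \bar R.
Implicit Types (s : seq R) (y : seq 'I_m.+1).

(* An edge of weight -oo gives 0, the value of the trivial path. *)
Definition contribution (v : R) (j : 'I_m.+1) : R :=
  if a j is x%:E then v + x else 0.

(* The value of a new vertex, s and y being the values of the earlier vertices
   and the weights of the edges from them. *)
Fixpoint arrival s y : R :=
  match s, y with
  | v :: s', j :: y' => Num.max (contribution v j) (arrival s' y')
  | _, _ => 0
  end.

Fixpoint insert (v : R) s : seq R :=
  if s is u :: s' then (if u <= v then v :: s else u :: insert v s') else [:: v].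

Definition front s : R := head 0 s.

Definition step s y := insert (arrival s y) s.

Definition is_config s := [&& sorted >=%R s, all (>= 0) s & s != [::]].

(** One translation serves all top ranks: increments of the maximum do not see it. *)
Definition agree (r : nat) s s' := exists t : R,
  [/\ (r <= size s)%N, (r <= size s')%N & take r s' = [seq x + t | x <- take r s]].

Lemma arrival_ge0 s y : 0 <= arrival s y.
Proof. by elim: s y => [|v s IH] [|j y] //=; rewrite le_max IH orbT. Qed.

Lemma insert_neq0 v s : insert v s != [::].
Proof. by case: s => //= u s; case: ifP. Qed.

Lemma size_insert v s : size (insert v s) = (size s).+1.
Proof. by elim: s => //= u s IH; case: ifP => //= _; rewrite IH. Qed.

Lemma front_insert v s : s != [::] -> front (insert v s) = Num.max v (front s).
Proof.
case: s => //= u s _; rewrite /front /=.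
case: ifPn => /=; first by move=> uv; rewrite max_l.
by rewrite -ltNge => vu; rewrite max_r// ltW.
Qed.

Lemma insert_shift v t s :
  insert (v + t) [seq x + t | x <- s] = [seq x + t | x <- insert v s].
Proof. by elim: s => //= u s IH; rewrite lerD2r; case: ifP => //=; rewrite IH. Qed.

(** The insertion then takes place among the first [r] entries and does not look further down. *)
Lemma take_insert v r s : has (<= v) (take r s) ->
  take r.+1 (insert v s) = insert v (take r s).
Proof.
elim: s r => [|u s IH] [|r] //=; case: (lerP u v) => //= uv h.
by rewrite -IH.
Qed.

Lemma is_config_insert v s : 0 <= v -> sorted >=%R s -> all (>= 0) s ->
  is_config (insert v s).
Proof.
move=> v0 ss s0; apply/and3P; split; last exact: insert_neq0.
- case: s ss {s0} => //= u s us; case: ifPn => /= [->//|].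
  rewrite -ltNge => /ltW; elim: s u us => [|w s IH] u /=; first by rewrite andbT.
  move=> /andP[uw ws] vu; case: ifPn => [wv|]; first by rewrite /= vu wv.
  by rewrite -ltNge => /ltW vw /=; rewrite uw IH.
- elim: s {ss} s0 => //= [|u s IH]; first by rewrite v0.
  by move=> /andP[u0 s0]; case: ifP => _ /=; rewrite ?v0 u0 ?s0 ?IH.
Qed.

Lemma is_config_step s y : is_config s -> is_config (step s y).
Proof. by case/and3P => ? ? _; apply: is_config_insert => //; exact: arrival_ge0. Qed.

Lemma agree0 s s' : agree 0 s s'.
Proof. by exists 0; rewrite !take0. Qed.

Lemma agree1 s s' : s != [::] -> s' != [::] -> agree 1 s s'.
Proof.
case: s s' => // u s [//|u' s'] _ _; exists (u' - u); split => //=.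
by rewrite !take0 /= addrC subrK.
Qed.

Lemma agree_leq r1 r2 s s' : (r1 <= r2)%N -> agree r2 s s' -> agree r1 s s'.
Proof.
move=> r12 [t [rs rs' tE]]; exists t; split; try exact: leq_trans r12 _.
by rewrite -(take_takel s' r12) tE -map_take take_takel.
Qed.

Variable alpha : R.
Hypotheses (a0E : a ord0 = alpha%:E) (alpha_gt0 : 0 < alpha).
Hypothesis a_le : forall j, (a j <= alpha%:E)%E.

Lemma contribution_le v u j : 0 <= u -> v <= u -> contribution v j <= u + alpha.
Proof.
move=> u0 vu; rewrite /contribution; have := a_le j.
by case: (a j) => [x| |] //=; rewrite ?lee_fin; [exact: lerD|move=> _; rewrite addr_ge0// ltW].
Qed.

Lemma arrival_le u s y : 0 <= u -> all (<= u) s -> arrival s y <= u + alpha.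
Proof.
move=> u0; elim: s y => [|v s IH] [|j y] /=; rewrite ?addr_ge0 ?(ltW alpha_gt0)//.
by move=> /andP[vu su]; rewrite ge_max contribution_le// IH.
Qed.

(** An edge of largest weight from the highest vertex dominates all later contributions: this is why
    letters stop at the first [ord0]. *)
Lemma arrival_hit u s y : 0 <= u -> all (<= u) s ->
  arrival (u :: s) (ord0 :: y) = u + alpha.
Proof. by move=> u0 su; rewrite /= /contribution a0E max_l// arrival_le. Qed.

Lemma sorted_ge_all u s : sorted >=%R (u :: s) -> all (<= u) s.
Proof. by move=> /= /(order_path_min ge_trans). Qed.

(** By [arrival_hit] only the values read up to the first [ord0] matter; they lie in the top [r],
    and maxima commute with translations. *)
Lemma arrival_shift r s s' y t : sorted >=%R s -> all (>= 0) s ->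
  sorted >=%R s' -> all (>= 0) s' -> (size y <= r)%N -> ord0 \in y ->
  (r <= size s)%N -> (r <= size s')%N ->
  take r s' = [seq x + t | x <- take r s] -> arrival s' y = arrival s y + t.
Proof.
elim: y r s s' => // j y IH [//|r] [//|u s] [//|u' s'].
move=> us /andP[u0 s0] us' /andP[u'0 s'0] yr hy rs rs' /= [u'E tE]; subst u'.
move: hy; rewrite inE => /orP[/eqP <-|hy].
  have -> : Num.max (contribution u ord0) (arrival s y) = u + alpha.
    by apply: arrival_hit => //; exact: sorted_ge_all.
  have -> : Num.max (contribution (u + t) ord0) (arrival s' y) = u + t + alpha.
    by apply: arrival_hit => //; exact: sorted_ge_all.
  by rewrite addrAC.
have E := IH r s s' (path_sorted us) s0 (path_sorted us') s'0 yr hy rs rs' tE.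
(* An infinite weight contributes 0, which is not translated; it is dominated on both sides because
   both arrivals are nonnegative. *)
have E0 : 0 <= arrival s y + t by rewrite -E arrival_ge0.
rewrite E addr_maxl /contribution; case: (a j) => [x| |]; first by rewrite addrAC.
- by rewrite (max_r E0) max_r// lerD2r arrival_ge0.
- by rewrite (max_r E0) max_r// lerD2r arrival_ge0.
Qed.

(** The origin of the edge [ord0] is in the top [r] and, as [alpha] is positive, below the arriving
    value. *)
Lemma arrival_has r s y : (size y <= r)%N -> ord0 \in y -> (r <= size s)%N ->
  has (<= arrival s y) (take r s).
Proof.
elim: y r s => // j y IH [//|r] [//|u s] yr hy rs /=.
move: hy; rewrite inE => /orP[/eqP <-|hy].
  by rewrite /contribution a0E le_max lerDl (ltW alpha_gt0).
apply/orP; right; apply: sub_has (IH r s yr hy rs) => x /= h.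
by rewrite le_max h orbT.
Qed.

(** The arriving value is translated by [arrival_shift] and lands within the common ranks by
    [arrival_has], so one more rank agrees. *)
Lemma agree_step r s s' y : is_config s -> is_config s' -> agree r s s' ->
  hits_within (maxn r 1) y ->
  agree r.+1 (step s y) (step s' y) /\
  front (step s y) - front s = front (step s' y) - front s'.
Proof.
move=> /and3P[ss s0 sn] /and3P[ss' s'0 s'n] rss'; set r1 := maxn r 1.
have r1ge : (r <= r1)%N by rewrite leq_maxl.
have r1gt : (0 < r1)%N by rewrite leq_max orbT.
(* Even at [r = 0] one rank agrees, since any two maxima differ by a translation. *)
have [t [r1s r1s' tE]] : agree r1 s s'.
  rewrite /r1; case: r rss' {r1 r1ge r1gt} => [_|r]; first exact: agree1.
  by rewrite (maxn_idPl _).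
move=> /andP[hy yr].
have E := arrival_shift ss s0 ss' s'0 yr hy r1s r1s' tE.
split.
  apply: (@agree_leq _ r1.+1); first by rewrite ltnS.
  exists t; rewrite /step !size_insert !ltnS; split => //.
  rewrite !take_insert ?arrival_has// E tE.
  exact: insert_shift.
rewrite /step !front_insert// E.
have -> : front s' = front s + t.
  move: tE r1gt; case: r1 {r1ge yr r1s r1s'} => // r1.
  by case: s sn s' s'n {ss s0 ss' s'0 rss' E} => // u s _ [//|u' s'] _ [-> _].
by rewrite -addr_maxl opprD addrACA subrr addr0.
Qed.

Lemma front_step_bounds s y : is_config s ->
  0 <= front (step s y) - front s <= alpha.
Proof.
move=> /and3P[ss s0 sn]; rewrite /step front_insert// subr_ge0 le_max lexx orbT /=.
rewrite lerBlDr ge_max lerDr (ltW alpha_gt0) andbT addrC.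
case: s sn ss s0 => // u s _ us /= /andP[u0 _].
have := @arrival_le u (u :: s) y u0; rewrite /= lexx /=.
by apply; exact: sorted_ge_all.
Qed.

End Fronts.

(** * The chain of configurations: coupling and variance *)

Section Chain.
Context {R : realType} {m : nat}.
Variables (a : 'I_m.+1 -> \bar R) (alpha : R).
Hypotheses (a0E : a ord0 = alpha%:E) (alpha_gt0 : 0 < alpha).
Hypothesis a_le : forall j, (a j <= alpha%:E)%E.
Implicit Types (p : 'I_m.+1 -> R) (s : seq R) (F : seq R -> R).

Fixpoint chain_mean p K n s F : R :=
  if n is n'.+1 then letter_mean p K (fun y => chain_mean p K n' (step a s y) F)
  else F s.

Definition drift p K n s : R :=
  chain_mean p K n.+1 s front - chain_mean p K n s front.

Lemma driftS p K n s :
  drift p K n.+1 s = letter_mean p K (fun y => drift p K n (step a s y)).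
Proof. by rewrite /drift letter_meanB. Qed.

Lemma drift0 p K s : \sum_i p i = 1 ->
  drift p K 0 s = letter_mean p K (fun y => front (step a s y) - front s).
Proof. by move=> p1; rewrite letter_meanB (letter_mean_cst _ _ p1). Qed.

Lemma chain_mean_front p K n s :
  chain_mean p K n s front - front s = \sum_(i < n) drift p K i s.
Proof.
elim: n => [|n IH]; first by rewrite big_ord0 subrr.
by rewrite big_ord_recr /= -IH /drift [RHS]addrC addrA subrK.
Qed.

Section Coupling.
Variables (M : nat) (r : R) (p : 'I_m.+1 -> 'rV[R]_M -> R) (b : 'I_m.+1 -> R).
Variables (phi : nat -> R) (rho : R).
Hypothesis r_ge0 : 0 <= r.
Hypothesis p_bounded : forall i, poly_bounded r (p i) (b i).
Hypothesis p_sum1 : forall h, \sum_i p i h = 1.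
Hypotheses (phi0 : phi 0%N = 1) (phi_ge0 : forall i, 0 <= phi i) (rho_ge0 : 0 <= rho).
Hypothesis phi_drift : forall K i, (i < K)%N ->
  letter_mean b K (fun y => phi (renew i y)) <= rho * phi i.

(** Both configurations read the same letters. After a hit the rank grows, after a miss the
    comparison restarts at rank 0, where [phi] is 1. At the last step a hit gives equal increments,
    and increments never differ by more than [alpha]. Each letter costs a factor [rho] by
    [phi_drift]; the rank stays below [K]. *)
Lemma drift_coupling n K i s s' : is_config s -> is_config s' -> agree i s s' ->
  (i + n < K)%N ->
  poly_bounded r (fun h => drift (p^~ h) K n s - drift (p^~ h) K n s')
    (alpha * rho ^+ n.+1 * phi i).
Proof.
elim: n i s s' => [|n IH] i s s' cs cs' ss' iK.
  have -> : (fun h => drift (p^~ h) K 0 s - drift (p^~ h) K 0 s') =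
    (fun h => letter_mean (p^~ h) K (fun y =>
      (front (step a s y) - front s) - (front (step a s' y) - front s'))).
    by apply/funext => h; rewrite [RHS]letter_meanB !drift0//; exact: p_sum1.
  apply: (@poly_bounded_le _ _ _ _ (letter_mean b K (fun y => alpha * phi (renew i y)))).
    apply: (@poly_bounded_letter_mean _ _ _ r_ge0 _ _ _ _ (fun y _ =>
      (front (step a s y) - front s) - (front (step a s' y) - front s'))) => // y.
    apply: poly_bounded_le (poly_bounded_cst _ _) _.
    rewrite /renew; case: ifPn => hit.
      have [_ ->] := agree_step a0E alpha_gt0 a_le cs cs' ss' hit.
      by rewrite subrr normr0 mulr_ge0// ltW.
    rewrite phi0 mulr1.
    have := front_step_bounds alpha_gt0 a_le y cs.
    have := front_step_bounds alpha_gt0 a_le y cs'.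
    by rewrite ler_norml; lra.
  rewrite letter_meanZ expr1 -mulrA ler_wpM2l ?(ltW alpha_gt0)//.
  by apply: phi_drift; rewrite addn0 in iK.
have -> : (fun h => drift (p^~ h) K n.+1 s - drift (p^~ h) K n.+1 s') =
    (fun h => letter_mean (p^~ h) K (fun y =>
      drift (p^~ h) K n (step a s y) - drift (p^~ h) K n (step a s' y))).
  by apply/funext => h; rewrite letter_meanB !driftS.
apply: (@poly_bounded_le _ _ _ _
    (letter_mean b K (fun y => alpha * rho ^+ n.+1 * phi (renew i y)))).
  apply: (@poly_bounded_letter_mean _ _ _ r_ge0 _ _ _ _ (fun y h =>
    drift (p^~ h) K n (step a s y) - drift (p^~ h) K n (step a s' y))) => // y.
  apply: IH; try exact: is_config_step.
    rewrite /renew; case: ifPn => hit; last exact: agree0.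
    by have [] := agree_step a0E alpha_gt0 a_le cs cs' ss' hit.
  rewrite /renew; case: ifPn => _; first by rewrite addSnnS.
  by rewrite (leq_trans _ iK)// ltnS add0n addnS leqW// leq_addl.
rewrite letter_meanZ [rho ^+ n.+2]exprSr !mulrA -[in leRHS]mulrA ler_wpM2l//.
  by rewrite mulr_ge0 ?exprn_ge0// ltW.
by apply: phi_drift; rewrite (leq_trans _ iK)// ltnS leq_addr.
Qed.

(** By the Markov property the drift at [n.+1] averages the drift at [n] over the first letter, so
    two starting configurations are compared, with no rank known to agree. *)
Lemma drift_increment n K s : is_config s -> (n.+1 < K)%N ->
  poly_bounded r (fun h => drift (p^~ h) K n.+1 s - drift (p^~ h) K n s)
    (letter_mean b K (fun=> 1) * alpha * rho ^+ n.+1).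
Proof.
move=> cs nK.
have -> : (fun h => drift (p^~ h) K n.+1 s - drift (p^~ h) K n s) =
    (fun h => letter_mean (p^~ h) K (fun y =>
      drift (p^~ h) K n (step a s y) - drift (p^~ h) K n s)).
  apply/funext => h; rewrite letter_meanB driftS.
  by rewrite (letter_mean_cst K (drift (p^~ h) K n s) (p_sum1 h)).
have -> : letter_mean b K (fun=> 1) * alpha * rho ^+ n.+1 =
    letter_mean b K (fun=> alpha * rho ^+ n.+1 * phi 0%N).
  rewrite phi0 mulr1 -mulrA mulrC -letter_meanZ.
  by apply: eq_letter_mean => y; rewrite mulr1.
apply: (@poly_bounded_letter_mean _ _ _ r_ge0 _ _ _ _ (fun y h =>
  drift (p^~ h) K n (step a s y) - drift (p^~ h) K n s)) => // y.
apply: drift_coupling => //; first exact: is_config_step.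
  exact: agree0.
by rewrite add0n ltnW.
Qed.

End Coupling.

Section Variance.
Variables (p : 'I_m.+1 -> R) (B : R) (K : nat).
Hypotheses (p_ge0 : forall i, 0 <= p i) (p_sum1 : \sum_i p i = 1).
Hypothesis osc : forall n s s', (n <= K)%N -> is_config s -> is_config s' ->
  `|(chain_mean p K n s front - front s) - (chain_mean p K n s' front - front s')| <= B.

(** The mean square about [x] exceeds the variance by [(G - x) ^+ 2], so [d ^+ 2] bounds the
    variance; the other term is the squared bias. *)
Lemma letter_mean_square_le g x c d : (forall y, `|g y - x| <= d) ->
  letter_mean p K (fun y => (g y - c) ^+ 2) <= d ^+ 2 + (letter_mean p K g - c) ^+ 2.
Proof.
move=> gd; set G := letter_mean p K g.
have E z : letter_mean p K (fun y => (g y - z) ^+ 2) =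
    letter_mean p K (fun y => (g y) ^+ 2) - 2 * z * G + z ^+ 2.
  rewrite -[z ^+ 2 in RHS](letter_mean_cst K _ p_sum1) -letter_meanZ -letter_meanB.
  rewrite -letter_meanD; apply: eq_letter_mean => y; ring.
have : letter_mean p K (fun y => (g y - x) ^+ 2) <= d ^+ 2.
  rewrite -(letter_mean_cst K (d ^+ 2) p_sum1); apply: ler_letter_mean => // y.
  by rewrite -real_normK ?num_real// lerXn2r ?nnegrE// (le_trans _ (gd y)).
have : 0 <= (G - x) ^+ 2 by exact: sqr_ge0.
rewrite !E; lra.
Qed.

(** A martingale estimate: reading a letter moves the conditional mean of the final maximum by at
    most [B + alpha], [B] coming from [osc] and [alpha] from the step itself. *)
Lemma chain_mean_square_le n s c : is_config s -> (n <= K)%N ->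
  chain_mean p K n s (fun t => (front t - c) ^+ 2) <=
    n%:R * (B + alpha) ^+ 2 + (chain_mean p K n s front - c) ^+ 2.
Proof.
elim: n s => [|n IH] s cs nK; first by rewrite mul0r add0r.
have nK' := ltnW nK.
apply: (@le_trans _ _ (letter_mean p K (fun y => n%:R * (B + alpha) ^+ 2 +
    (chain_mean p K n (step a s y) front - c) ^+ 2))).
  by apply: ler_letter_mean => // y; exact: IH (is_config_step _ _ cs) nK'.
rewrite letter_meanD letter_mean_cst// -natr1 mulrDl mul1r -addrA lerD2l.
apply: (@letter_mean_square_le _ (chain_mean p K n s front)) => y.
have := osc nK' (is_config_step a y cs) cs.
have := front_step_bounds alpha_gt0 a_le y cs.
rewrite !ler_norml; lra.
Qed.

End Variance.

End Chain.

(** * Means over independently redrawn weights *)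

Section EdgeMeans.
Context {R : realType} {m : nat}.
Variable p : 'I_m.+1 -> R.
Implicit Types (x : nat * nat -> 'I_m.+1) (es : seq (nat * nat)).

Definition update x e j : nat * nat -> 'I_m.+1 := fun e' => if e' == e then j else x e'.

(* Mean of F when the weights on es are redrawn independently and those off es
   are kept. *)
Fixpoint edge_mean es (F : (nat * nat -> 'I_m.+1) -> R) x : R :=
  if es is e :: es' then \sum_j p j * edge_mean es' F (update x e j) else F x.

Fixpoint column_mean (n : nat) (H : seq 'I_m.+1 -> R) : R :=
  if n is n'.+1 then \sum_j p j * column_mean n' (fun y => H (j :: y)) else H [::].

Definition eq_off es x x' := forall e, e \notin es -> x' e = x e.

Lemma eq_off_update e es j x x' : e \notin es -> eq_off es (update x e j) x' ->
  eq_off (e :: es) x x' /\ x' e = j.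
Proof.
move=> ees xx'; split; last by rewrite xx'// /update eqxx.
move=> e'; rewrite inE negb_or => /andP[e'e e'es].
by rewrite xx'// /update (negbTE e'e).
Qed.

Lemma eq_edge_mean es F F' x : uniq es ->
  (forall x', eq_off es x x' -> F x' = F' x') -> edge_mean es F x = edge_mean es F' x.
Proof.
elim: es x => [|e es IH] x /=; first by move=> _; apply.
move=> /andP[ees us] FF'; apply: eq_bigr => j _; congr (_ * _).
by apply: IH => // x' /(eq_off_update ees)[+ _]; exact: FF'.
Qed.

Lemma edge_mean_cat es es' F x :
  edge_mean (es ++ es') F x = edge_mean es (edge_mean es' F) x.
Proof. by elim: es x => //= e es IH x; apply: eq_bigr => j _; rewrite IH. Qed.

Lemma edge_meanZ es c F x : edge_mean es (fun x' => c * F x') x = c * edge_mean es F x.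
Proof.
elim: es x => //= e es IH x; rewrite mulr_sumr; apply: eq_bigr => j _.
by rewrite IH mulrCA.
Qed.

Lemma edge_mean_column es F H x : uniq es ->
  (forall x', eq_off es x x' -> F x' = H (map x' es)) ->
  edge_mean es F x = column_mean (size es) H.
Proof.
elim: es F H x => [|e es IH] F H x /=; first by move=> _; apply.
move=> /andP[ees us] FH; apply: eq_bigr => j _; congr (_ * _).
apply: IH => // x' /(eq_off_update ees)[xx' <-].
exact: FH.
Qed.

Lemma eq_column_mean n H H' : H =1 H' -> column_mean n H = column_mean n H'.
Proof. by move=> e; congr column_mean; apply/funext. Qed.

Hypothesis p_sum1 : \sum_i p i = 1.

Lemma column_mean_cst n c : column_mean n (fun=> c) = c.
Proof.
elim: n => //= n IH; under eq_bigr do rewrite IH.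
by rewrite -mulr_suml p_sum1 mul1r.
Qed.

Hypothesis p_ge0 : forall i, 0 <= p i.

Lemma ler_edge_mean es F F' x : (forall x', F x' <= F' x') ->
  edge_mean es F x <= edge_mean es F' x.
Proof.
move=> FF'; elim: es x => //= e es IH x.
by apply: ler_sum => j _; rewrite ler_wpM2l.
Qed.

End EdgeMeans.

(** * The chain as the law of the ranked vertex values *)

Section ExploredValues.
Context {R : realType} {m : nat}.
Variables (a : 'I_m.+1 -> \bar R) (alpha : R) (p : 'I_m.+1 -> R).
Implicit Types (x : nat * nat -> 'I_m.+1) (s : seq R).

(** The origins decrease, to match the order of [vertex_values]. *)
Definition column t : seq (nat * nat) := [seq (i, t) | i <- rev (iota 0 t)].

(* The values of the vertices t, ..., 0: the largest weights of paths ending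
   there, with any starting point, and 0 for the trivial path. *)
Fixpoint vertex_values x t : seq R :=
  if t is t'.+1 then
    arrival a (vertex_values x t') (map x (column t)) :: vertex_values x t'
  else [:: 0].

Definition ranked_values x t : seq R := foldr insert [::] (vertex_values x t).

Definition columns t n : seq (nat * nat) := flatten [seq column k | k <- iota t.+1 n].

Lemma mem_column e t : (e \in column t) = (e.1 < t)%N && (e.2 == t).
Proof.
case: e => i k /=; apply/mapP/andP => [[j]|[it /eqP ->]].
  by rewrite mem_rev mem_iota /= add0n => jt [-> ->].
by exists i; rewrite // mem_rev mem_iota.
Qed.

Lemma column_uniq t : uniq (column t).
Proof. by rewrite map_inj_uniq ?rev_uniq ?iota_uniq// => i j []. Qed.

Lemma size_column t : size (column t) = t.
Proof. by rewrite size_map size_rev size_iota. Qed.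

Lemma eq_vertex_values x x' t :
  (forall i k, (i < k <= t)%N -> x' (i, k) = x (i, k)) ->
  vertex_values x' t = vertex_values x t.
Proof.
elim: t => //= t IH xx'; rewrite IH; last first.
  by move=> i k /andP[ik kt]; rewrite xx'// ik leqW.
congr (arrival _ _ _ :: _); apply/eq_in_map => -[i k].
by rewrite mem_column /= => /andP[it /eqP ->]; rewrite xx'// it leqnn.
Qed.

Lemma size_vertex_values x t : size (vertex_values x t) = t.+1.
Proof. by elim: t => //= t ->. Qed.

Lemma size_sort s : size (foldr insert [::] s) = size s.
Proof. by elim: s => //= v s IH; rewrite size_insert IH. Qed.

Lemma ranked_values_config x t : is_config (ranked_values x t).
Proof.
elim: t => [|t IH]; first by rewrite /is_config /= lexx.
have /and3P[? ? _] := IH.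
by apply: is_config_insert => //; exact: arrival_ge0.
Qed.

(* Exchangeability of the edges into a new vertex. *)
Lemma column_mean_insert v s G :
  column_mean p (size s).+1 (fun y => G (arrival a (insert v s) y)) =
  column_mean p (size s).+1 (fun y => G (arrival a (v :: s) y)).
Proof.
elim: s G => // u s IH G; rewrite [insert _ _]/=; case: ifPn => // _.
transitivity (\sum_j p j * column_mean p (size s).+1
    (fun y => G (Num.max (contribution a u j) (arrival a (v :: s) y)))).
  apply: eq_bigr => j _; congr (_ * _).
  exact: (IH (fun z => G (Num.max (contribution a u j) z))).
rewrite /=; under eq_bigr do rewrite mulr_sumr.
rewrite exchange_big /=; apply: eq_bigr => k _; rewrite mulr_sumr.
apply: eq_bigr => j _; rewrite mulrCA; do 2 congr (_ * _).
by apply: eq_column_mean => y; rewrite maxCA.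
Qed.

Lemma column_mean_sort s G :
  column_mean p (size s) (fun y => G (arrival a (foldr insert [::] s) y)) =
  column_mean p (size s) (fun y => G (arrival a s y)).
Proof.
elim: s G => // v s IH G; rewrite [foldr _ _ _]/=.
have := column_mean_insert v (foldr insert [::] s) G; rewrite size_sort => ->.
apply: eq_bigr => j _; congr (_ * _).
exact: (IH (fun z => G (Num.max (contribution a v j) z))).
Qed.

Hypotheses (a0E : a ord0 = alpha%:E) (alpha_gt0 : 0 < alpha).
Hypothesis a_le : forall j, (a j <= alpha%:E)%E.
Hypothesis p_sum1 : \sum_i p i = 1.

(** The weights after the first [ord0] do not affect the arrival and average out; cutting at [K] is
    harmless since [arrival] stops at the end of [s]. *)
Lemma column_mean_letter K s G : sorted >=%R s -> all (>= 0) s -> (size s <= K)%N ->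
  column_mean p (size s) (fun y => G (arrival a s y)) =
  letter_mean p K (fun y => G (arrival a s y)).
Proof.
elim: s K G => [|u s IH] K G us; first by move=> _ _; rewrite /= letter_mean_cst.
have su := sorted_ge_all us.
move=> /andP[u0 s0]; case: K => // K sK.
rewrite [LHS]/= big_ord_recl [RHS]/=; congr (_ + _).
  congr (_ * _); rewrite -/(arrival a (u :: s) [:: ord0]) (arrival_hit a0E)//.
  rewrite -[RHS](column_mean_cst p_sum1 (size s)); apply: eq_column_mean => y.
  by rewrite -/(arrival a (u :: s) (ord0 :: y)) (arrival_hit a0E).
apply: eq_bigr => j _; congr (_ * _).
exact: (IH K (fun z => G (Num.max (contribution a u (lift ord0 j)) z)) (path_sorted us)).
Qed.

(** Column by column: sorting the earlier values, then cutting the column into a letter, turns fresh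
    weights into one step of the chain. *)
Lemma edge_mean_columns K t n F x : (t + n <= K)%N ->
  edge_mean p (columns t n) (fun x' => F (ranked_values x' (t + n))) x =
  chain_mean a p K n (ranked_values x t) F.
Proof.
elim: n t x => [|n IH] t x tnK; first by rewrite addn0.
rewrite [columns _ _]/= edge_mean_cat [RHS]/=.
set G := fun z => chain_mean a p K n (insert z (ranked_values x t)) F.
rewrite (@edge_mean_column _ _ _ _ _ (fun y => G (arrival a (vertex_values x t) y))).
- rewrite size_column -(size_vertex_values x t) -column_mean_sort.
  have /and3P[? ? _] := ranked_values_config x t.
  rewrite -(size_sort (vertex_values x t)) (@column_mean_letter K)//.
  rewrite size_sort size_vertex_values (leq_trans _ tnK)//.
  by rewrite addnS ltnS leq_addr.
- exact: column_uniq.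
move=> x' xx'; rewrite -/(columns t.+1 n).
have tn : (t.+1 + n <= K)%N by rewrite addSnnS.
have := IH t.+1 x' tn; rewrite addSnnS => ->.
have E : vertex_values x' t = vertex_values x t.
  apply: eq_vertex_values => i k /andP[ik kt]; apply: xx'.
  by rewrite mem_column /= negb_and (ltn_eqF (leq_ltn_trans kt (ltnSn t))) orbT.
by rewrite /ranked_values [vertex_values _ t.+1]/= E.
Qed.

End ExploredValues.

(** * Paths and last passage values *)

Section PathValues.
Context {R : realType} {m : nat}.
Variables (a : 'I_m.+1 -> \bar R) (alpha : R) (x : nat * nat -> 'I_m.+1).

Definition vertex_value t : R := head 0 (vertex_values a x t).

Definition top_value t : R := front (ranked_values a x t).

Lemma vertex_valuesE t :
  vertex_values a x t = [seq vertex_value i | i <- rev (iota 0 t.+1)].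
Proof.
elim: t => // t IH.
have -> : rev (iota 0 t.+2) = t.+1 :: rev (iota 0 t.+1).
  by rewrite -[t.+2]addn1 iotaD rev_cat.
by rewrite map_cons -IH.
Qed.

Lemma arrival_map_ge (f : nat -> R) (g : nat -> 'I_m.+1) r i : i \in r ->
  contribution a (f i) (g i) <= arrival a (map f r) (map g r).
Proof.
elim: r => //= k r IH; rewrite inE => /orP[/eqP <-|ir]; rewrite le_max ?lexx//.
by rewrite IH ?orbT.
Qed.

Lemma arrival_map_attained (f : nat -> R) (g : nat -> 'I_m.+1) r :
  arrival a (map f r) (map g r) = 0 \/
  exists2 i, i \in r & arrival a (map f r) (map g r) = contribution a (f i) (g i).
Proof.
elim: r => [|k r IH] /=; first by left.
case: (leP (contribution a (f k) (g k)) (arrival a (map f r) (map g r))) => h.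
  case: IH => [->|[i ir ->]]; first by left.
  by right; exists i => //; rewrite inE ir orbT.
by right; exists k; rewrite ?mem_head.
Qed.

Lemma vertex_valueS t : vertex_value t.+1 =
  arrival a [seq vertex_value i | i <- rev (iota 0 t.+1)]
            [seq x (i, t.+1) | i <- rev (iota 0 t.+1)].
Proof. by rewrite {1}/vertex_value [LHS]/= vertex_valuesE /column -map_comp. Qed.

Lemma vertex_value_ge0 t : 0 <= vertex_value t.
Proof. by case: t => [|t]; rewrite ?vertex_valueS ?arrival_ge0// lexx. Qed.

Lemma vertex_value_ge i t (v : R) : (i < t)%N -> a (x (i, t)) = v%:E ->
  vertex_value i + v <= vertex_value t.
Proof.
case: t => // t it av; rewrite vertex_valueS.
have := @arrival_map_ge vertex_value (fun i => x (i, t.+1)) (rev (iota 0 t.+1)) i.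
by rewrite mem_rev mem_iota /contribution av; exact.
Qed.

Lemma vertex_value_attained t : vertex_value t = 0 \/
  exists i v, [/\ (i < t)%N, a (x (i, t)) = v%:E & vertex_value t = vertex_value i + v].
Proof.
case: t => [|t]; first by left.
rewrite vertex_valueS.
have [->|[i]] := @arrival_map_attained vertex_value (fun i => x (i, t.+1)) (rev (iota 0 t.+1)).
  by left.
rewrite mem_rev mem_iota /= add0n => it ->; rewrite /contribution.
case E: (a (x (i, t.+1))) => [v| |]; [|by left..].
by right; exists i, v.
Qed.

Lemma ranked_values_neq0 t : ranked_values a x t != [::].
Proof. by have /and3P[] := ranked_values_config a x t. Qed.

Lemma top_valueS t : top_value t.+1 = Num.max (vertex_value t.+1) (top_value t).
Proof. by rewrite /top_value /ranked_values /= front_insert// ranked_values_neq0. Qed.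

Lemma top_value0 : top_value 0 = 0. Proof. by []. Qed.

Lemma top_value_homo : {homo top_value : i t / (i <= t)%N >-> i <= t}.
Proof.
apply: homo_leq => [|u v w|t]; [exact: lexx|exact: le_trans|].
by rewrite top_valueS le_max lexx orbT.
Qed.

Lemma vertex_value_le_top i t : (i <= t)%N -> vertex_value i <= top_value t.
Proof.
move=> it; apply: le_trans (top_value_homo it).
by case: i {it} => // i; rewrite top_valueS le_max lexx.
Qed.

Lemma top_value_attained t : exists2 i, (i <= t)%N & top_value t = vertex_value i.
Proof.
elim: t => [|t [i it IH]]; first by exists 0%N.
rewrite top_valueS; case: (leP (vertex_value t.+1) (top_value t)) => _.
  by exists i; rewrite // leqW.
by exists t.+1.
Qed.

Hypothesis a_le : forall j, (a j <= alpha%:E)%E.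

Lemma weight_le e v : a e = v%:E -> v <= alpha.
Proof. by move=> av; have := a_le e; rewrite av lee_fin. Qed.

Section PositiveTop.
Hypothesis alpha_ge0 : 0 <= alpha.

Lemma top_valueS_le t : top_value t.+1 <= top_value t + alpha.
Proof.
rewrite top_valueS ge_max lerDl alpha_ge0 andbT.
have [->|[i [v [it /weight_le va ->]]]] := vertex_value_attained t.+1.
  by rewrite addr_ge0// (le_trans (vertex_value_ge0 t))// vertex_value_le_top.
by rewrite lerD// vertex_value_le_top.
Qed.

Lemma top_valueD_le t g : top_value (t + g) <= top_value t + g%:R * alpha.
Proof.
elim: g => [|g IH]; first by rewrite addn0 mul0r addr0.
rewrite addnS (le_trans (top_valueS_le _))// -natr1 mulrDl mul1r addrA.
by rewrite lerD2r.
Qed.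

Lemma vertex_value_le t : vertex_value t <= t%:R * alpha.
Proof.
apply: le_trans (vertex_value_le_top (leqnn t)) _.
by have := top_valueD_le 0 t; rewrite add0n top_value0 add0r.
Qed.

End PositiveTop.

Variable X : nat * nat -> \bar R.
Hypothesis XE : forall i k, (i < k)%N -> X (i, k) = a (x (i, k)).

Lemma path_weight_cons i k s :
  path_weight X i (k :: s) = (X (i, k) + path_weight X k s)%E.
Proof. by rewrite /path_weight /= big_cons. Qed.

Lemma path_weight_rcons i s k :
  path_weight X i (rcons s k) = (path_weight X i s + X (last i s, k))%E.
Proof.
elim: s i => [|u s IH] i /=.
  by rewrite path_weight_cons /path_weight !big_nil adde0 add0e.
by rewrite !path_weight_cons IH addeA.
Qed.

Hypothesis a_lty : forall j, (a j < +oo)%E.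

Lemma path_weight_le i s : path ltn i s ->
  ((vertex_value i)%:E + path_weight X i s <= (vertex_value (last i s))%:E)%E.
Proof.
elim: s i => [|k s IH] i /=; first by rewrite /path_weight big_nil adde0.
move=> /andP[ik ks]; apply: le_trans (IH k ks).
rewrite path_weight_cons addeA leeD2r// XE//.
case E: (a (x (i, k))) => [v| |].
- by rewrite -EFinD lee_fin vertex_value_ge.
- by have := a_lty (x (i, k)); rewrite E.
- by rewrite addeNy leNye.
Qed.

Lemma last_passage_le n : (last_passage X n <= (top_value n)%:E)%E.
Proof.
apply: ge_ereal_sup => _ [s [ps <-] <-].
apply: (@le_trans _ _ (vertex_value (last 0%N s))%:E); last first.
  by rewrite lee_fin vertex_value_le_top.
by have := path_weight_le ps; rewrite add0e.
Qed.

Definition reaches (n : nat) (w : R) : Prop :=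
  exists2 s, paths_to n s & (w%:E <= path_weight X 0 s)%E.

Lemma reaches_last_passage n w : reaches n w -> (w%:E <= last_passage X n)%E.
Proof.
move=> [s sn ws]; apply: le_trans ws _; apply: ereal_sup_ubound.
by exists s.
Qed.

Lemma reaches0 : reaches 0 0.
Proof. by exists [::]; rewrite // /path_weight big_nil. Qed.

Lemma reaches_le n w w' : reaches n w -> w' <= w -> reaches n w'.
Proof. by move=> [s sn ws] w'w; exists s => //; apply: le_trans ws; rewrite lee_fin. Qed.

Lemma reaches_edge i k w v : reaches i w -> (i < k)%N -> a (x (i, k)) = v%:E ->
  reaches k (w + v).
Proof.
move=> [s [ps lasts] ws] ik av; exists (rcons s k).
  by split; rewrite ?last_rcons// rcons_path ps lasts /=.
by rewrite path_weight_rcons lasts XE// av EFinD leeD2r.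
Qed.

Definition connected i k : Prop :=
  exists z, [/\ (i < z < k)%N, x (i, z) = ord0 & x (z, k) = ord0].

Hypothesis a0E : a ord0 = alpha%:E.

Lemma reaches_connected i k w : reaches i w -> connected i k ->
  reaches k (w + alpha + alpha).
Proof.
move=> rw [z [/andP[iz zk] x1 x2]].
by apply: (@reaches_edge z) => //; rewrite ?x2//; apply: (@reaches_edge i); rewrite ?x1.
Qed.

(** An optimal path is attached to 0 and to [n] by giving up at most [g] vertices at each end, at a
    cost of at most [g%:R * alpha] per end. *)
Lemma last_passage_ge n g : 0 <= alpha -> (0 < g <= n)%N ->
  (forall i, (g <= i <= n)%N -> connected 0 i) ->
  (forall i, (i <= n - g)%N -> connected i n) ->
  ((top_value n - 2 * g%:R * alpha)%:E <= last_passage X n)%E.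
Proof.
move=> alpha0 /andP[g0 gn] c0 cn; apply: reaches_last_passage.
have r0 i : (g <= i <= n)%N -> reaches i 0.
  move=> /c0 /(reaches_connected reaches0) /reaches_le; apply.
  by rewrite add0r addr_ge0.
(* Induction along an optimal path ending at [i]: its part within the first [g] vertices is replaced
   by a connection from 0. *)
have rL i : (g <= i <= n)%N -> reaches i (vertex_value i - g%:R * alpha).
  elim/ltn_ind: i => i IH gin.
  have ga0 : 0 <= g%:R * alpha by rewrite mulr_ge0.
  have [->|[j [v [ji av ->]]]] := vertex_value_attained i.
    by apply: reaches_le (r0 _ gin) _; rewrite sub0r oppr_le0.
  case: (leqP g j) => gj.
    have /andP[_ iN] := gin.
    have := IH j ji; rewrite gj (leq_trans (ltnW ji) iN) => /(_ isT) rj.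
    by have := reaches_edge rj ji av; rewrite addrAC.
  apply: reaches_le (r0 _ gin) _; rewrite subr_le0.
  apply: (@le_trans _ _ (j.+1%:R * alpha)); last by rewrite ler_wpM2r// ler_nat.
  by rewrite -natr1 mulrDl mul1r lerD ?vertex_value_le ?(weight_le av).
have topn : top_value n <= top_value (n - g) + g%:R * alpha.
  by have := top_valueD_le alpha0 (n - g) g; rewrite subnK.
have [i ing topi] := top_value_attained (n - g).
have iN : (i <= n)%N by rewrite (leq_trans ing)// leq_subr.
case: (leqP g i) => gi.
  have := reaches_connected (rL i _) (cn i ing); rewrite gi iN => /(_ isT) /reaches_le.
  by apply; lra.
(* Here the whole top value is at most [2 * g%:R * alpha], and weight 0 suffices. *)
apply: reaches_le (r0 n _) _; first by rewrite gn leqnn.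
have h1 := vertex_value_le alpha0 i.
have h2 : i%:R * alpha <= g%:R * alpha by rewrite ler_wpM2r// ler_nat ltnW.
lra.
Qed.

Lemma last_passage_nonpos n : alpha <= 0 -> (last_passage X n <= 0)%E.
Proof.
move=> alpha0; apply: ge_ereal_sup => _ [s [ps _] <-].
elim: s 0%N ps => [|k s IH] i /=; first by rewrite /path_weight big_nil.
move=> /andP[ik ks]; rewrite path_weight_cons -[leRHS]adde0 leeD ?IH//.
by rewrite XE// (le_trans (a_le _))// lee_fin.
Qed.

Lemma last_passage_ge2 n : connected 0 n -> ((alpha + alpha)%:E <= last_passage X n)%E.
Proof.
move=> /(reaches_connected reaches0); rewrite add0r.
exact: reaches_last_passage.
Qed.

End PathValues.

(** * Almost sure convergence *)

Section BorelCantelli.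
Context {R : realType} d (T : measurableType d) (P : probability T R).

(* P U <= c for some measurable U covering A: a bound on the outer probability
   of A, so that the measurability of A need not be checked. *)
Definition outer_le (A : set T) (c : R) : Prop :=
  exists U, [/\ measurable U, A `<=` U & (P U <= c%:E)%E].

Lemma outer_le_sub A B c c' : A `<=` B -> c <= c' -> outer_le B c -> outer_le A c'.
Proof.
move=> AB cc' [U [mU BU PU]]; exists U; split => //; first exact: subset_trans BU.
by apply: le_trans PU _; rewrite lee_fin.
Qed.

Lemma outer_le_bigU (I : Type) (s : seq I) (A : I -> set T) (c : I -> R) :
  (forall i, outer_le (A i) (c i)) ->
  outer_le (\big[setU/set0]_(i <- s) A i) (\sum_(i <- s) c i).
Proof.
move=> Ac; elim: s => [|i s [V [mV sV PV]]].
  by rewrite !big_nil; exists set0; split => //; rewrite measure0.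
have [U [mU iU PU]] := Ac i.
rewrite !big_cons; exists (U `|` V); split; [exact: measurableU|exact: setUSS|].
apply: le_trans (measureU2 _ mU mV) _.
by rewrite EFinD leeD.
Qed.

Lemma borel_cantelli_outer (A : nat -> set T) (c : nat -> R) (C : R) :
  (forall n, outer_le (A n) (c n)) -> (forall n, \sum_(0 <= k < n) c k <= C) ->
  {ae P, forall w, exists n0, forall n, (n0 <= n)%N -> ~ A n w}.
Proof.
move=> /choice[U /all_and3[mU AU PU]] cC.
have h : P (lim_sup_set U) = 0.
  apply: lim_sup_set_cvg0 => //; apply: (@le_lt_trans _ _ C%:E); last exact: ltry.
  apply: lime_le; first by apply: is_cvg_ereal_nneg_natsum => n _; exact: measure_ge0.
  apply: nearW => n; apply: (@le_trans _ _ (\sum_(0 <= k < n) c k)%:E).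
    by rewrite -sumEFin; apply: lee_sum => k _; exact: PU.
  by rewrite lee_fin.
exists (lim_sup_set U); split => //.
  by apply: bigcapT_measurable => n; apply: bigcup_measurable => k _; exact: mU.
move=> w /= nw n _; apply: contrapT => nU; apply: nw; exists n => k nk Akw.
by apply: nU; exists k => //; exact: AU.
Qed.

End BorelCantelli.

(** * Events determined by finitely many weights *)

Section WeightEvents.
Context {R : realType} {m : nat} d (T : measurableType d) (P : probability T R).
Variables (a : 'I_m.+1 -> \bar R) (q : 'I_m.+1 -> R).
Variables (nu : set (\bar R) -> \bar R) (X : nat * nat -> {RV P >-> \bar R}).
Hypotheses (a_inj : injective a) (q_ge0 : forall i, 0 <= q i).
Hypothesis nuE : forall A, nu A = (\sum_i (q i)%:E * \d_(a i) A)%E.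
Hypothesis X_iid : iid_weights nu X.

Lemma weight_probability e i : edges e -> P (X e @^-1` [set a i]) = (q i)%:E.
Proof.
move=> ee; have [_ /(_ e ee _ (emeasurable_set1 (a i)))] := X_iid.
rewrite /distribution /pushforward => ->; rewrite nuE (bigD1 i)//= big1 ?adde0.
  by rewrite diracE mem_set// mule1.
by move=> j ji; rewrite diracE memNset ?mule0// => /a_inj/eqP; rewrite (negbTE ji).
Qed.

Definition realizes (w : T) (x : nat * nat -> 'I_m.+1) : Prop :=
  forall e, edges e -> X e w = a (x e).

(** There are countably many edges, and each weight lies almost surely in the range of [a]. *)
Lemma ae_realizes : {ae P, forall w, exists x, realizes w x}.
Proof.
have h i k : {ae P, forall w, edges (i, k) -> exists j, X (i, k) w = a j}.
  have [ee|] := pselect (edges (i, k)); last by move=> ne; apply: aeW.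
  have mr : measurable (range a).
    have -> : range a = \bigcup_(j in [set: 'I_m.+1]) [set a j].
      by apply/seteqP; split => [_ [j _ <-]|_ [j _ ->]]; exists j.
    by apply: fin_bigcup_measurable => // j _; exact: emeasurable_set1.
  exists (X (i, k) @^-1` (~` range a)); split.
  - by rewrite -[X in measurable X]setTI; apply: measurable_funP => //; exact: measurableC.
  - have [_ /(_ _ ee _ (measurableC mr))] := X_iid.
    rewrite /distribution /pushforward => ->; rewrite nuE big1// => j _.
    by rewrite diracE memNset ?mule0// => /(_ (imageT a j)).
  - move=> w nw [j _ aj]; apply: nw => _; exists j.
    by rewrite aj.
have h2 : {ae P, forall w, forall i k, edges (i, k) -> exists j, X (i, k) w = a j}.
  apply: (ae_foralln (P := fun i w => forall k, edges (i, k) -> exists j, X (i, k) w = a j)) => i.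
  apply: (ae_foralln (P := fun k w => edges (i, k) -> exists j, X (i, k) w = a j)) => k.
  exact: h.
apply: filterS h2 => w hw.
have : forall e, exists j, edges e -> X e w = a j.
  move=> [i k]; have [/hw[j Xj]|ne] := pselect (edges (i, k)); first by exists j.
  by exists ord0.
by move=> /choice[x xP]; exists x.
Qed.

Lemma cylinder_probability (s : seq (nat * nat)) x : uniq s ->
  (forall e, e \in s -> edges e) ->
  P (\bigcap_(e in [set` s]) (X e @^-1` [set a (x e)])) = (\prod_(e <- s) q (x e))%:E.
Proof.
move=> us se; have [indep _] := X_iid.
pose f : {fset nat * nat} := [fset e in s]%fset.
have fs : [set` f] = [set` s] by apply/seteqP; split => e /=; rewrite inE.
have pfs : perm_eq f s.
  by apply: uniq_perm => // e; rewrite inE.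
have := indep f (fun e => [set a (x e)]); rewrite fs => ->.
- rewrite (perm_big _ pfs) /= -prodEFin big_seq [RHS]big_seq.
  by apply: eq_bigr => e /se ee; exact: weight_probability.
- by move=> e /se.
- by move=> e; exact: emeasurable_set1.
Qed.

(** The weights on [s] are already fixed, which accounts for the product; each induction step fixes
    one more edge by splitting on its value. *)
Lemma outer_le_edge_mean (s es : seq (nat * nat)) (A : pred (nat * nat -> 'I_m.+1)) x :
  uniq (s ++ es) -> (forall e, e \in s ++ es -> edges e) ->
  (forall x x', (forall e, e \in s ++ es -> x e = x' e) -> A x = A x') ->
  outer_le P [set w | exists x', [/\ realizes w x', A x' & forall e, e \in s -> x' e = x e]]
    ((\prod_(e <- s) q (x e)) * edge_mean q es (fun x' => (A x')%:R) x).
Proof.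
elim: es s x => [|e es IH] s x.
  rewrite cats0 => us se Aloc /=; case: (boolP (A x)) => Ax.
    exists (\bigcap_(e in [set` s]) (X e @^-1` [set a (x e)])); split.
    - rewrite bigcap_seq big_seq; apply: bigsetI_measurable => e es.
      by rewrite -[X in measurable X]setTI; apply: measurable_funP => //; exact: emeasurable_set1.
    - move=> w [x' [wx' _ x'x]] e es; rewrite /= wx' ?x'x//; exact: se.
    - by rewrite mulr1 cylinder_probability.
  exists set0; split => //; last by rewrite mulr0 measure0.
  move=> w [x' [wx' Ax' x'x]]; move: Ax; rewrite (Aloc _ x') ?Ax'// => e es.
  by rewrite x'x.
move=> us se Aloc.
have pe : perm_eq (rcons s e ++ es) (s ++ e :: es) by rewrite cat_rcons.
have es' : e \notin s.
  by move: us; rewrite cat_uniq => /and3P[_ /hasPn/(_ e (mem_head _ _))].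
have {}IH j := IH (rcons s e) (update x e j).
apply: (@outer_le_sub _ _ _ _ _ (\big[setU/set0]_(j <- index_enum 'I_m.+1)
   [set w | exists x', [/\ realizes w x', A x' &
     forall e', e' \in rcons s e -> x' e' = update x e j e']]) _ _ _ (lexx _)).
  move=> w [x' [wx' Ax' x'x]].
  rewrite -bigcup_seq; exists (x' e); first by rewrite /= mem_index_enum.
  exists x'; split => // e'; rewrite mem_rcons inE /update => /orP[/eqP ->|e's].
    by rewrite eqxx.
  by case: eqP => [->//|_]; exact: x'x.
have E j : q j * \prod_(e <- s) q (x e) = \prod_(e' <- rcons s e) q (update x e j e').
  rewrite big_rcons /= /update eqxx mulrC; congr (_ * _).
  by apply: eq_big_seq => e' e's; case: eqP e's => // ->; rewrite (negbTE es').
have -> : \prod_(e <- s) q (x e) * edge_mean q (e :: es) (fun x' => (A x')%:R) x =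
    \sum_j \prod_(e' <- rcons s e) q (update x e j e') *
      edge_mean q es (fun x' => (A x')%:R) (update x e j).
  by rewrite /= mulr_sumr; apply: eq_bigr => j _; rewrite mulrCA mulrA E.
apply: outer_le_bigU => j; apply: IH.
- by rewrite (perm_uniq pe).
- by move=> e'; rewrite (perm_mem pe); exact: se.
- by move=> y y' yy'; apply: Aloc => e' e's; apply: yy'; rewrite (perm_mem pe).
Qed.

Lemma outer_le_event (es : seq (nat * nat)) (A : pred (nat * nat -> 'I_m.+1)) x :
  uniq es -> (forall e, e \in es -> edges e) ->
  (forall x x', (forall e, e \in es -> x e = x' e) -> A x = A x') ->
  outer_le P [set w | exists2 x', realizes w x' & A x']
    (edge_mean q es (fun x' => (A x')%:R) x).
Proof.
move=> us se Aloc; have := @outer_le_edge_mean [::] es A x us se Aloc.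
by rewrite big_nil mul1r; apply: outer_le_sub => // w [x' wx' Ax']; exists x'.
Qed.

End WeightEvents.

(** * Elementary bounds on sums *)

Section Sums.
Context {R : realType}.

Lemma sum_inv_square_le n : \sum_(0 <= k < n) (k.+1%:R ^+ 2)^-1 <= 2 :> R.
Proof.
case: n => [|n]; first by rewrite big_geq.
apply: (@le_trans _ _ (2 - n.+1%:R^-1)); last by rewrite gerBl invr_ge0.
elim: n => [|n IH]; first by rewrite big_nat1 expr1n invr1; lra.
rewrite big_nat_recr//= (le_trans (lerD IH (lexx _)))//.
rewrite -lerBrDl opprB [leRHS](_ : _ = n.+1%:R^-1 - n.+2%:R^-1); last by ring.
have h1 : n.+1%:R != 0 :> R by rewrite pnatr_eq0.
have h2 : n.+2%:R != 0 :> R by rewrite pnatr_eq0.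
have -> : n.+1%:R^-1 - n.+2%:R^-1 = (n.+1%:R * n.+2%:R)^-1 :> R.
  have G (u : R) : u != 0 -> u + 1 != 0 -> u^-1 - (u + 1)^-1 = (u * (u + 1))^-1.
    by move=> u0 u1; field; rewrite u0 u1.
  by rewrite -[n.+2%:R]natr1 G// natr1.
rewrite lef_pV2 ?posrE ?exprn_gt0 ?mulr_gt0//.
by rewrite expr2 ler_wpM2r// ler_nat.
Qed.

(** The exponent is constant on blocks of length [k]. *)
Lemma sum_expr_divn_le (r : R) k n : 0 < r < 1 -> (0 < k)%N ->
  \sum_(0 <= i < n) r ^+ (i %/ k) <= k%:R / (1 - r).
Proof.
move=> /andP[r0 r1] k0.
have E J : \sum_(0 <= i < J * k) r ^+ (i %/ k) = k%:R * \sum_(0 <= j < J) r ^+ j.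
  elim: J => [|J IH]; first by rewrite !big_geq// mulr0.
  rewrite (@big_cat_nat _ _ _ (J * k)) ?leq_mul2r ?leqnSn ?orbT//= IH.
  rewrite [X in _ = _ * X]big_nat_recr//= mulrDr; congr (_ + _).
  rewrite -{1}[(J * k)%N]add0n big_addn mulSn addnK big_mkord.
  rewrite (eq_bigr (fun=> r ^+ J)).
    by rewrite sumr_const card_ord mulr_natl.
  by move=> i _; rewrite addnC divnMDl// divn_small// addn0.
apply: (@le_trans _ _ (\sum_(0 <= i < n * k) r ^+ (i %/ k))).
  rewrite [leRHS](@big_cat_nat _ _ _ n)//= ?leq_pmulr// lerDl.
  by apply: sumr_ge0 => i _; rewrite exprn_ge0// ltW.
rewrite E ler_wpM2l//.
have := @geometric_tail_le _ 1 r 0 n ler01; rewrite (ltW r0) r1 => /(_ isT).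
by rewrite expr0 mulr1; under eq_bigr do rewrite mul1r; rewrite mul1r.
Qed.

Lemma sum_expr_sub_le (r : R) g n : 0 < r < 1 -> (g <= n)%N ->
  \sum_(i < (n - g).+1) r ^+ (n - i) <= r ^+ g / (1 - r).
Proof.
move=> /andP[r0 r1] gn.
have := @geometric_tail_le _ 1 r g n.+1 ler01; rewrite (ltW r0) r1 => /(_ isT).
rewrite mul1r; apply: le_trans; rewrite le_eqVlt; apply/orP; left; apply/eqP.
under [RHS]eq_bigr do rewrite mul1r.
rewrite -[X in index_iota X _]add0n big_addn subSn// big_nat_rev /= add0n big_mkord.
apply: eq_bigr => i _; congr (_ ^+ _).
have := ltn_ord i; rewrite ltnS => ing.
by rewrite subSS subnAC subnK// leq_subRL ?(leq_trans ing) ?leq_subr// addnC -leq_subRL.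
Qed.

End Sums.

(** * Two-edge connections *)

Section Connections.
Context {R : realType} {m : nat}.
Variable q : 'I_m.+1 -> R.
Hypotheses (q_sum1 : \sum_i q i = 1).
Implicit Types x : nat * nat -> 'I_m.+1.

Definition links (i n : nat) (zs : seq nat) : seq (nat * nat) :=
  flatten [seq [:: (i, z); (z, n)] | z <- zs].

Definition unlinked (i n : nat) (zs : seq nat) x : bool :=
  ~~ has (fun z => (x (i, z) == ord0) && (x (z, n) == ord0)) zs.

Lemma mem_links i n zs e : (e \in links i n zs) =
  has (fun z => (e == (i, z)) || (e == (z, n))) zs.
Proof.
by elim: zs => //= z zs IH; rewrite !inE IH orbA.
Qed.

Lemma links_uniq i n zs : uniq zs -> (forall z, z \in zs -> (i < z < n)%N) ->
  uniq (links i n zs).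
Proof.
elim: zs => //= z zs IH /andP[zzs uzs] zin.
have /andP[iz zn] := zin z (mem_head _ _).
rewrite !inE IH//; last by move=> z' z'zs; apply: zin; rewrite inE z'zs orbT.
rewrite negb_or -/(links i n zs) !mem_links xpair_eqE (ltn_eqF iz) /= andbT.
rewrite -!all_predC; apply/andP; split; apply/allP => z' z'zs /=.
  have /andP[iz' z'n] : (i < z' < n)%N by apply: zin; rewrite inE z'zs orbT.
  rewrite !xpair_eqE eqxx /= (ltn_eqF iz') /= orbF.
  by apply/eqP => zz'; move: zzs; rewrite zz' z'zs.
have /andP[iz' z'n] : (i < z' < n)%N by apply: zin; rewrite inE z'zs orbT.
rewrite !xpair_eqE eqxx andbT (gtn_eqF iz) /=.
by apply/eqP => zz'; move: zzs; rewrite zz' z'zs.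
Qed.

(** Distinct middle vertices use disjoint pairs of edges, and both weights of a pair are largest
    with probability [q ord0 ^+ 2]. *)
Lemma edge_mean_unlinked i n zs x : uniq zs ->
  (forall z, z \in zs -> (i < z < n)%N) ->
  edge_mean q (links i n zs) (fun x' => (unlinked i n zs x')%:R) x =
    (1 - q ord0 ^+ 2) ^+ size zs.
Proof.
elim: zs x => //= z zs IH x uz zin.
have /andP[zzs uzs] := uz.
have /andP[iz zn] := zin z (mem_head _ _).
have zin' z' : z' \in zs -> (i < z' < n)%N.
  by move=> z'zs; apply: zin; rewrite inE z'zs orbT.
have ulz := @links_uniq i n (z :: zs) uz zin.
rewrite -/(links i n zs).
transitivity (\sum_j q j * \sum_k q k *
    ((~~ ((j == ord0) && (k == ord0)))%:R * (1 - q ord0 ^+ 2) ^+ size zs)).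
  apply: eq_bigr => j _; congr (_ * _); apply: eq_bigr => k _; congr (_ * _).
  set x' := update _ _ _.
  rewrite -(IH x' uzs zin') -edge_meanZ; apply: eq_edge_mean.
    exact: links_uniq.
  move=> x'' xx''.
  move: ulz; rewrite /links /= -/(links i n zs) inE negb_or => /andP[/andP[_ izl] /andP[znl _]].
  have izn : ((i, z) == (z, n)) = false by rewrite xpair_eqE (ltn_eqF iz).
  rewrite /unlinked /= negb_or -mulnb natrM; congr (_ * _).
  have -> : x'' (i, z) = j by rewrite xx''// /x' /update izn eqxx.
  by have -> : x'' (z, n) = k by rewrite xx''// /x' /update eqxx.
transitivity (\sum_j q j * (\sum_k q k - (j == ord0)%:R * q ord0) *
   (1 - q ord0 ^+ 2) ^+ size zs).
  apply: eq_bigr => j _; rewrite -mulrA; congr (_ * _).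
  under eq_bigr do rewrite mulrA; rewrite -mulr_suml; congr (_ * _).
  case: (j == ord0) => /=; last by under eq_bigr do rewrite mulr1; rewrite mul0r subr0.
  rewrite !big_ord_recl /= mulr0 add0r mul1r addrAC subrr add0r.
  by apply: eq_bigr => k _; rewrite mulr1.
rewrite -mulr_suml [RHS]exprS; congr (_ * _).
rewrite q_sum1; under eq_bigr do rewrite mulrBr mulr1.
rewrite sumrB q_sum1; congr (_ - _).
rewrite big_ord_recl /= mul1r big1 ?addr0 ?expr2// => j _.
by rewrite mul0r mulr0.
Qed.

End Connections.

(** * Almost sure connection and concentration *)

Section AlmostSure.
Context {R : realType} {m : nat} d (T : measurableType d) (P : probability T R).
Variables (a : 'I_m.+1 -> \bar R) (q : 'I_m.+1 -> R) (alpha : R).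
Variables (nu : set (\bar R) -> \bar R) (X : nat * nat -> {RV P >-> \bar R}).
Hypotheses (a_inj : injective a) (q_ge0 : forall i, 0 <= q i).
Hypothesis nuE : forall A, nu A = (\sum_i (q i)%:E * \d_(a i) A)%E.
Hypothesis X_iid : iid_weights nu X.
Hypotheses (q_sum1 : \sum_i q i = 1) (q0_gt0 : 0 < q ord0).
Hypothesis a0E : a ord0 = alpha%:E.
Hypothesis a_le : forall j, (a j <= alpha%:E)%E.

(** Failure at [i] has probability [rho ^+ (n - i.+1)]; the sum over [i] is of order
    [r ^+ (n %/ k)], summable in [n]. *)
Lemma ae_connected k : (0 < k)%N ->
  {ae P, forall w, exists n0, forall n, (n0 <= n)%N -> forall x, realizes a X w x ->
    forall i, (i <= n - n %/ k)%N -> connected x i n}.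
Proof.
move=> k0.
have q0_le1 : q ord0 <= 1.
  by rewrite -q_sum1 big_ord_recl lerDl; apply: sumr_ge0.
pose rho := 1 - q ord0 ^+ 2.
have rho0 : 0 <= rho by rewrite subr_ge0 exprn_ile1// ltW.
have rho1 : rho < 1 by rewrite gtrBl exprn_gt0.
(* The maximum keeps [r] positive when [q ord0 = 1]: a division by [r] will absorb the shift from
   [n - i] to [n - i.+1]. *)
pose r := Num.max rho 2^-1.
have r01 : 0 < r < 1.
  rewrite lt_max gt_max rho1 invf_lt1// ltr1n andbT.
  by rewrite invr_gt0 ltr0n orbT.
have /andP[r0 r1] := r01.
pose zs i n := iota i.+1 (n - i.+1).
have zsP i n z : z \in zs i n -> (i < z < n)%N.
  rewrite mem_iota => /andP[iz zi]; rewrite iz /=.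
  case: (leqP i.+1 n) => iN; first by rewrite subnKC in zi.
  move: zi; rewrite (eqP (ltnW iN : (n <= i.+1)%N)) addn0.
  by rewrite ltnNge iz.
pose A n := [set w | exists2 x, realizes a X w x &
  exists2 i, (i <= n - n %/ k)%N & ~ connected x i n].
have A_outer n : outer_le P (A n) (r ^+ (n %/ k) * ((1 - r)^-1 / r)).
  apply: (@outer_le_sub _ _ _ _ _ (\big[setU/set0]_(i <- index_enum 'I_(n - n %/ k).+1)
     [set w | exists2 x, realizes a X w x & unlinked i n (zs i n) x])
     (\sum_(i < (n - n %/ k).+1) r ^+ (n - i) / r)).
  - move=> w [x wx [i ing nc]]; rewrite -bigcup_seq.
    exists (Ordinal (ing : (i < (n - n %/ k).+1)%N)); first by rewrite /= mem_index_enum.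
    exists x => //=; apply/hasPn => z zi; apply/negP => /andP[/eqP x1 /eqP x2].
    by apply: nc; exists z; split => //; exact: zsP.
  - rewrite -mulr_suml mulrA ler_wpM2r ?invr_ge0 ?(ltW r0)//.
    by apply: sum_expr_sub_le; rewrite // leq_div.
  apply: outer_le_bigU => i.
  have := @outer_le_event _ _ _ _ P a q nu X a_inj nuE X_iid (links i n (zs i n))
    (unlinked i n (zs i n)) (fun=> ord0).
  rewrite (edge_mean_unlinked q_sum1 _ (iota_uniq _ _) (zsP i n)) size_iota => h.
  have rle : rho ^+ (n - i.+1) <= r ^+ (n - i) / r.
    rewrite ler_pdivlMr//.
    apply: (@le_trans _ _ (r ^+ (n - i.+1) * r)).
      rewrite ler_wpM2r ?(ltW r0)// lerXn2r ?nnegrE ?(ltW r0)//.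
      by rewrite /r le_max lexx.
    by rewrite -exprSr ler_wiXn2l ?(ltW r0) ?(ltW r1)// subnS; case: (n - i)%N.
  apply: outer_le_sub rle (h _ _ _) => //.
  - by apply: links_uniq; [exact: iota_uniq|exact: zsP].
  - move=> e; rewrite mem_links => /hasP[z /zsP/andP[iz zn]].
    by case/orP => /eqP ->.
  - move=> x x' xx'; congr (~~ _); apply: eq_in_has => z zi.
    by rewrite !xx'// mem_links; apply/hasP; exists z => //; rewrite eqxx ?orbT.
have := @borel_cantelli_outer _ _ _ P A _ (k%:R / (1 - r) * ((1 - r)^-1 / r)) A_outer.
have h n : \sum_(0 <= i < n) r ^+ (i %/ k) * ((1 - r)^-1 / r) <=
    k%:R / (1 - r) * ((1 - r)^-1 / r).
  rewrite -mulr_suml ler_wpM2r ?mulr_ge0 ?invr_ge0 ?subr_ge0 ?(ltW r0) ?(ltW r1)//.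
  exact: sum_expr_divn_le.
move=> /(_ h); apply: filterS => w [n0 hn0]; exists n0 => n n0n x wx i ing.
by apply: contrapT => nc; apply: (hn0 n n0n); exists x => //; exists i.
Qed.

Lemma mem_columns t n e : (e \in columns t n) = (e.1 < e.2)%N && (t < e.2 <= t + n)%N.
Proof.
rewrite /columns; apply/flatten_mapP/andP => [[k]|[e12 et]].
  rewrite mem_iota mem_column addSn ltnS => tk /andP[ek /eqP ->].
  by rewrite ek.
exists e.2; first by rewrite mem_iota addSn ltnS.
by rewrite mem_column e12 eqxx.
Qed.

Lemma columns_uniq t n : uniq (columns t n).
Proof.
elim: n t => // n IH t; rewrite /columns /= -/(columns t.+1 n).
rewrite cat_uniq column_uniq IH andbT /= -all_predC; apply/allP => e /=.
rewrite mem_columns mem_column => /and3P[_ te _].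
by rewrite (gtn_eqF te) andbF.
Qed.

Hypothesis alpha_gt0 : 0 < alpha.

Definition mean_top n : R := chain_mean a q n n [:: 0] front.

Variable B : R.
Hypothesis osc : forall K n s s', (n <= K)%N -> is_config s -> is_config s' ->
  `|(chain_mean a q K n s front - front s) -
    (chain_mean a q K n s' front - front s')| <= B.

(** Chebyshev's inequality with the variance bound [chain_mean_square_le]. *)
Lemma outer_le_deviation n e : 0 < e ->
  outer_le P [set w | exists2 x, realizes a X w x & e <= `|top_value a x n - mean_top n|]
    (n%:R * (B + alpha) ^+ 2 / e ^+ 2).
Proof.
move=> e0.
pose A : pred (nat * nat -> 'I_m.+1) := fun x => e <= `|top_value a x n - mean_top n|.
have Aloc x x' : (forall e, e \in columns 0 n -> x e = x' e) -> A x = A x'.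
  move=> xx'; rewrite /A /top_value /ranked_values (@eq_vertex_values _ _ a x')//.
  move=> i k /andP[ik kn]; apply: xx'.
  by rewrite mem_columns /= ik add0n kn (leq_ltn_trans _ ik).
have Aedges e' : e' \in columns 0 n -> edges e' by rewrite mem_columns => /andP[].
apply: outer_le_sub (outer_le_event a_inj nuE X_iid (fun=> ord0)
  (columns_uniq 0 n) Aedges Aloc) => //.
apply: (@le_trans _ _ (edge_mean q (columns 0 n) (fun x =>
    (e ^+ 2)^-1 * (front (ranked_values a x (0 + n)) - mean_top n) ^+ 2) (fun=> ord0))).
  apply: ler_edge_mean => // x; rewrite /A /=; case: (lerP e) => h /=.
    rewrite ler_pdivlMl ?exprn_gt0// mulr1.
    by rewrite -[leRHS]real_normK ?num_real// lerXn2r ?nnegrE// ltW.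
  by rewrite mulr_ge0 ?sqr_ge0// invr_ge0 sqr_ge0.
rewrite edge_meanZ.
rewrite (@edge_mean_columns _ _ a alpha q a0E alpha_gt0 a_le q_sum1 n 0 n
  (fun t => (front t - mean_top n) ^+ 2))//.
rewrite mulrC ler_wpM2r ?invr_ge0 ?sqr_ge0//.
have cs0 : is_config [:: 0 : R] by rewrite /is_config /= lexx.
have osc' := fun n' s s' => @osc n n' s s'.
have := chain_mean_square_le alpha_gt0 a_le q_ge0 q_sum1 osc' (mean_top n) cs0 (leqnn n).
by rewrite subrr expr0n addr0.
Qed.

(** At a deviation proportional to [n] the bound is of order [1 / n], which is summable along the
    squares. *)
Lemma ae_top_concentrated k : (0 < k)%N ->
  {ae P, forall w, exists n0, forall n, (n0 <= n)%N -> forall x, realizes a X w x ->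
    `|top_value a x (n.+1 ^ 2) - mean_top (n.+1 ^ 2)| < (n.+1 ^ 2)%:R / k%:R}.
Proof.
move=> k0.
pose A n := [set w | exists2 x, realizes a X w x &
  (n.+1 ^ 2)%:R / k%:R <= `|top_value a x (n.+1 ^ 2) - mean_top (n.+1 ^ 2)|].
have kk : 0 < k%:R :> R by rewrite ltr0n.
have A_outer n : outer_le P (A n) ((n.+1%:R ^+ 2)^-1 * ((B + alpha) ^+ 2 * k%:R ^+ 2)).
  have e0 : 0 < (n.+1 ^ 2)%:R / k%:R :> R by rewrite divr_gt0// ltr0n expn_gt0.
  apply: outer_le_sub (outer_le_deviation (n.+1 ^ 2) e0) => //.
  have E (N u c : R) : N != 0 -> u != 0 ->
      N ^+ 2 * c / (N ^+ 2 / u) ^+ 2 = (N ^+ 2)^-1 * (c * u ^+ 2).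
    by move=> N0 u0; field; rewrite N0 u0.
  by rewrite natrX E ?pnatr_eq0 ?gt_eqF.
have h n : \sum_(0 <= i < n) ((i.+1%:R ^+ 2)^-1 * ((B + alpha) ^+ 2 * k%:R ^+ 2)) <=
    2 * ((B + alpha) ^+ 2 * k%:R ^+ 2).
  rewrite -mulr_suml; apply: ler_wpM2r; last exact: sum_inv_square_le.
  by rewrite mulr_ge0 ?sqr_ge0.
have := borel_cantelli_outer A_outer h.
apply: filterS => w [n0 hn0]; exists n0 => n n0n x wx.
by rewrite ltNge; apply/negP => nc; apply: (hn0 n n0n); exists x.
Qed.

End AlmostSure.

(** * From squares to all integers, from top values to last passage values *)

Section Interpolation.
Context {R : realType}.

Lemma ex_natr_ge (x : R) : exists n : nat, x <= n%:R.
Proof.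
exists (Num.bound `|x|); apply: le_trans (ler_norm x) _.
exact/ltW/archi_boundP.
Qed.

Lemma ex_sqrtn N : exists n, (n ^ 2 <= N < n.+1 ^ 2)%N.
Proof.
elim: N => [|N [n /andP[nN Nn]]]; first by exists 0%N.
case: (leqP (n.+1 ^ 2) N.+1) => h; last by exists n; rewrite h (leqW nN).
by exists n.+1; rewrite h /= (leq_ltn_trans Nn)// ltn_exp2r.
Qed.

(** [t] is monotone, and the ratio of consecutive squares tends to 1. *)
Lemma cvg_of_squares (t u : nat -> R) (C : R) :
  {homo t : i n / (i <= n)%N >-> i <= n} -> 0 <= t 0%N ->
  u n / n%:R @[n --> \oo] --> C ->
  (forall k, (0 < k)%N -> exists n0, forall n, (n0 <= n)%N ->
    `|t (n.+1 ^ 2)%N - u (n.+1 ^ 2)%N| < (n.+1 ^ 2)%:R / k%:R) ->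
  t n / n%:R @[n --> \oo] --> C.
Proof.
move=> t_homo t0 uC tu.
have t_ge0 n : 0 <= t n by apply: le_trans t0 _; exact: t_homo.
have sq e : 0 < e -> exists n0, forall n, (n0 <= n)%N ->
    `|t (n ^ 2)%N - C * n%:R ^+ 2| <= e * n%:R ^+ 2.
  move=> e0; have [k ke] := ex_natr_ge (2 / e).
  have k0 : (0 < k)%N by rewrite -(ltr0n R) (lt_le_trans _ ke)// divr_gt0.
  have [n0 hn0] := tu k k0.
  have /cvgrPdist_le /(_ _ (divr_gt0 e0 (ltr0n R 2)))[n1 _ hn1] := uC.
  exists (maxn n0 n1).+1 => -[//|n]; rewrite ltnS geq_max => /andP[n0n n1n].
  set N := (n.+1 ^ 2)%N.
  have N0 : 0 < N%:R :> R by rewrite ltr0n expn_gt0.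
  have n1N : (n1 <= N)%N.
    by rewrite (leq_trans n1n)// /N -mulnn (leq_trans (leqnSn n))// leq_pmulr.
  have h1 : `|t N - u N| <= e / 2 * N%:R.
    apply: le_trans (ltW (hn0 n n0n)) _; rewrite -/N mulrC ler_wpM2r ?(ltW N0)//.
    by rewrite -[e / 2]invf_div lef_pV2 ?posrE ?divr_gt0// ltr0n.
  have h2 : `|u N - C * N%:R| <= e / 2 * N%:R.
    have := hn1 N n1N; rewrite /= distrC => h.
    have -> : u N - C * N%:R = (u N / N%:R - C) * N%:R.
      by rewrite mulrBl divfK// gt_eqF.
    by rewrite normrM (gtr0_norm N0) ler_wpM2r// ltW.
  rewrite -natrX -/N (_ : t N - _ = (t N - u N) + (u N - C * N%:R)); last by ring.
  apply: le_trans (ler_normD _ _) _.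
  by rewrite (le_trans (lerD h1 h2))// -mulrDl -splitr.
have C0 : 0 <= C.
  rewrite leNgt; apply/negP => C0.
  have C'0 : 0 < - C / 2 by rewrite divr_gt0// oppr_gt0.
  have [n0 hn0] := sq _ C'0.
  have N0 : 0 < n0.+1%:R ^+ 2 :> R by rewrite exprn_gt0// ltr0n.
  have := hn0 n0.+1 (leqnSn _); have := t_ge0 (n0.+1 ^ 2)%N.
  have : C * n0.+1%:R ^+ 2 < 0 by rewrite pmulr_llt0.
  by rewrite ler_norml; move: (t _) => z; lra.
apply/cvgrPdist_le => e' e'0.
(* The upper bound will be [(C + e) * (1 + e) = C + e * (C + 1 + e)], and [C + 1 + e <= C + 2]. *)
pose e := Num.min 1 (e' / (C + 2)).
have C2 : 0 < C + 2 by rewrite ltr_wpDl.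
have e0 : 0 < e by rewrite lt_min ltr01 divr_gt0.
have e1 : e <= 1 by rewrite ge_min lexx.
have ee' : e * (C + 2) <= e'.
  by rewrite -ler_pdivlMr// ge_min lexx orbT.
have [n1 hn1] := sq e e0.
(* From [n >= 3 / e] follows [(n + 1) ^ 2 - n ^ 2 <= 3 * n <= e * n ^ 2]. *)
have [n2 hn2] := ex_natr_ge (3 / e).
exists ((maxn n1 n2).+1 ^ 2)%N => // N /= nN.
have [n /andP[nN1 nN2]] := ex_sqrtn N.
have nmax : ((maxn n1 n2).+1 <= n)%N.
  by rewrite -ltnS -(@ltn_exp2r _ _ 2)// (leq_ltn_trans nN).
have [n1n n2n] : (n1 <= n)%N /\ (n2 <= n)%N.
  by move: (ltnW nmax); rewrite geq_max => /andP.
have n0 : (0 < n)%N by exact: leq_ltn_trans nmax.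
have N0 : (0 < N)%N by rewrite (leq_trans _ nN1)// expn_gt0 n0.
have NR0 : 0 < N%:R :> R by rewrite ltr0n.
pose x : R := n%:R.
have ex : 3 <= e * x.
  by rewrite mulrC -ler_pdivrMr// (le_trans hn2)// ler_nat.
have x1 : 1 <= x by rewrite -[1](natrX R 1 1) ler_nat.
have xN : x ^+ 2 <= N%:R by rewrite -natrX ler_nat.
have Nx : N%:R <= (x + 1) ^+ 2 by rewrite /x natr1 -natrX ler_nat ltnW.
have exx : 3 * x <= e * x ^+ 2 by rewrite expr2 mulrA ler_wpM2r// ltW// (lt_le_trans ltr01).
have eN : e * x ^+ 2 <= e * N%:R by rewrite ler_wpM2l// ltW.
have tn1 : t N <= t (n.+1 ^ 2)%N by apply: t_homo; exact: ltnW.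
have tn2 : t (n ^ 2)%N <= t N by exact: t_homo.
have := hn1 _ (leq_trans n1n (leqnSn n)); have := hn1 _ n1n.
rewrite -[n.+1%:R]natr1 -/x; move=> lower upper.
have N1 : (x + 1) ^+ 2 <= (1 + e) * N%:R by clear -x1 xN exx eN; lra.
have N2 : (1 - e) * N%:R <= x ^+ 2 by clear -x1 Nx exx eN; lra.
have p1 : (C + e) * (x + 1) ^+ 2 <= (C + e) * ((1 + e) * N%:R).
  by rewrite ler_wpM2l// addr_ge0// ltW.
have p2 : C * ((1 - e) * N%:R) <= C * x ^+ 2 by rewrite ler_wpM2l.
have p3 : e * (C + 2) * N%:R <= e' * N%:R by rewrite ler_wpM2r// ltW.
have p4 : e * (e * N%:R) <= e * N%:R.
  by rewrite ler_wpM2l ?(ltW e0)// ler_piMl// ltW.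
have p5 : e * x ^+ 2 <= e * N%:R by [].
have p6 : 0 <= e * N%:R by rewrite mulr_ge0// ltW.
have := lower; have := upper; rewrite !ler_norml => /andP[_ upper'] /andP[lower' _].
have -> : C - t N / N%:R = (C * N%:R - t N) / N%:R by rewrite mulrBl mulfK// gt_eqF.
rewrite ler_pdivlMr// ler_pdivrMr//.
clear -p1 p2 p3 p4 p5 p6 upper' lower' tn1 tn2.
by apply/andP; split; lra.
Qed.

Lemma cvg_last_passage (W : nat -> \bar R) (t : nat -> R) (C alpha : R) :
  0 <= alpha -> t n / n%:R @[n --> \oo] --> C ->
  (forall k, (1 < k)%N -> exists n0, forall n, (n0 <= n)%N ->
    ((t n - 2 * (n %/ k)%:R * alpha)%:E <= W n <= (t n)%:E)%E) ->
  (W n * (n%:R^-1)%:E)%E @[n --> \oo] --> C%:E.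
Proof.
move=> alpha0 tC Wt.
have WE n : ((t n - 2 * (n %/ 2)%:R * alpha)%:E <= W n <= (t n)%:E)%E ->
    W n = (fine (W n))%:E.
  move=> /andP[h1 h2]; rewrite fineK// fin_numE.
  by apply/andP; split; apply/negP => /eqP WN; rewrite WN in h1 h2.
(* The sandwich for a single [k] already makes [W n] finite for large [n]. *)
have [n0 hn0] := Wt 2 isT.
apply/fine_cvgP; split.
  by exists n0 => // n /= /hn0/WE ->.
apply/cvgrPdist_le => e e0.
(* Then the gap [2 * (n %/ k.+2) * alpha] is at most [e / 2 * n]. *)
have [k ke] := ex_natr_ge (4 * alpha / e).
have [n1 hn1] := Wt k.+2 isT.
have /cvgrPdist_le /(_ _ (divr_gt0 e0 (ltr0n R 2)))[n2 _ hn2] := tC.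
exists (maxn n0 (maxn n1 n2)).+1 => // n /= nn.
have := ltnW nn; rewrite !geq_max => /and3P[n0n n1n n2n].
have nR : 0 < n%:R :> R by rewrite ltr0n (leq_ltn_trans _ nn).
have Wn := WE n (hn0 n n0n).
have := hn1 n n1n; rewrite Wn !lee_fin /= => /andP[w1 w2].
have := hn2 n n2n => /= d2.
have -> : C - fine (W n) / n%:R = (C - t n / n%:R) + (t n - fine (W n)) / n%:R.
  by rewrite mulrBl addrA subrK.
apply: le_trans (ler_normD _ _) _; rewrite (splitr e) lerD//.
rewrite ger0_norm ?divr_ge0 ?subr_ge0 ?(ltW nR)// ler_pdivrMr//.
have k2 : (n %/ k.+2)%:R * k.+2%:R <= n%:R :> R by rewrite -natrM ler_nat leq_trunc_div.
have ke' : 4 * alpha <= e * k.+2%:R.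
  rewrite [leRHS]mulrC -ler_pdivrMr//.
  by apply: le_trans ke _; rewrite ler_nat -addn2 leq_addr.
have : 4 * alpha * (n %/ k.+2)%:R <= e * k.+2%:R * (n %/ k.+2)%:R.
  by rewrite ler_wpM2r.
have : e * ((n %/ k.+2)%:R * k.+2%:R) <= e * n%:R by rewrite ler_wpM2l// ltW.
move: w1; move: (fine _) (n %/ k.+2)%:R k.+2%:R n%:R => w g k' n'.
clear; lra.
Qed.

End Interpolation.

(** * An i.i.d. family of weights *)

Section UnitInterval.
Context {R : realType}.

Definition unit_itv : set R := `[0%R, 1%R[%classic.

Lemma measurable_unit_itv : measurable unit_itv.
Proof. exact: measurable_itv. Qed.

Definition unit_probability := mrestr (@lebesgue_measure R) measurable_unit_itv.

HB.instance Definition _ := Measure.on unit_probability.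

Let unit_probability_setT : unit_probability setT = 1%E.
Proof.
rewrite /unit_probability /mrestr setTI /unit_itv lebesgue_measure_itv /= lte01.
by rewrite sube0.
Qed.

HB.instance Definition _ :=
  Measure_isProbability.Build _ _ _ unit_probability unit_probability_setT.

End UnitInterval.

(* The digits of u in [0, 1[ obtained by splitting [0, 1[ into consecutive
   intervals of lengths q_0, ..., q_m, and iterating in the interval found. *)
Section Digits.
Context {R : realType} {m : nat}.
Variable q : 'I_m.+1 -> R.
Hypotheses (q_ge0 : forall i, 0 <= q i) (q_sum1 : \sum_i q i = 1).

Definition cumul (n : nat) : R := \sum_(i < m.+1 | (i < n)%N) q i.

Definition digit (u : R) : 'I_m.+1 :=
  odflt ord0 [pick j : 'I_m.+1 | cumul j <= u < cumul j.+1].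

Definition shift (u : R) : R := (u - cumul (digit u)) / q (digit u).

Definition word (n : nat) (u : R) : seq 'I_m.+1 := map digit (traject shift u n).

Fixpoint lower (y : seq 'I_m.+1) : R :=
  if y is j :: y' then cumul j + q j * lower y' else 0.

Definition mass (y : seq 'I_m.+1) : R := \prod_(j <- y) q j.

Lemma cumulS (j : 'I_m.+1) : cumul j.+1 = cumul j + q j.
Proof.
rewrite /cumul (bigD1 j)//= addrC; congr (_ + _).
by apply: eq_bigl => i; rewrite ltnS [RHS]ltn_neqAle andbC.
Qed.

Lemma cumul_homo : {homo cumul : i n / (i <= n)%N >-> i <= n}.
Proof.
move=> i n lein; rewrite /cumul big_mkcond [leRHS]big_mkcond /=.
apply: ler_sum => j _; case: ifP => [ji|_]; last by case: ifP.
by rewrite (leq_trans ji lein).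
Qed.

Lemma cumul0 : cumul 0 = 0. Proof. by rewrite /cumul big_pred0. Qed.

Lemma cumul_ge0 n : 0 <= cumul n.
Proof. by rewrite -cumul0 cumul_homo. Qed.

Lemma cumul_max : cumul m.+1 = 1.
Proof. by rewrite -q_sum1 /cumul; apply: eq_bigl => i; rewrite ltn_ord. Qed.

Lemma digitP u j : 0 <= u < 1 -> (digit u == j) = (cumul j <= u < cumul j.+1).
Proof.
move=> /andP[u0 u1].
have uniq_digit i k : cumul i <= u < cumul i.+1 -> cumul k <= u < cumul k.+1 -> (i <= k)%N.
  move=> /andP[iu _] /andP[_ uk]; rewrite leqNgt; apply/negP => ki.
  by have := lt_le_trans uk (le_trans (cumul_homo ki) iu); rewrite ltxx.
have [k kP] : exists k : 'I_m.+1, cumul k <= u < cumul k.+1.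
  have : exists n, u < cumul n.+1 by exists m; rewrite cumul_max.
  move=> ex; case: (ex_minnP ex) => n un nmin.
  have nm : (n < m.+1)%N by rewrite ltnS nmin// cumul_max.
  exists (Ordinal nm) => /=; rewrite un andbT.
  case: n un nmin nm => [|n] un nmin nm; first by rewrite cumul0.
  by rewrite leNgt; apply/negP => /nmin; rewrite ltnn.
rewrite /digit; case: pickP => [i iP|/(_ k)]; last by rewrite kP.
apply/eqP/idP => [<-//|jP].
by apply/val_inj/eqP; rewrite eqn_leq; apply/andP; split; exact: uniq_digit.
Qed.

Lemma lower_bounds y : 0 <= lower y /\ lower y + mass y <= 1.
Proof.
elim: y => [|j y [l0 l1]] /=; first by rewrite /mass big_nil add0r.
split; first by rewrite addr_ge0 ?cumul_ge0// mulr_ge0.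
rewrite /mass big_cons -/(mass y) -addrA -mulrDr.
rewrite (@le_trans _ _ (cumul j + q j))//; first by rewrite lerD2l ler_piMr.
by rewrite -cumulS -cumul_max cumul_homo.
Qed.

(** Points whose digits start with [y] fill an interval of length [mass y]. The interval of a digit
    of mass 0 is empty, so [shift] divides by a positive mass. *)
Lemma wordP y u : 0 <= u < 1 ->
  (word (size y) u == y) = (lower y <= u < lower y + mass y).
Proof.
elim: y u => [|j y IH] u u01 /=; first by rewrite /mass big_nil add0r u01.
rewrite /word /= eqseq_cons -/(word (size y) (shift u)) digitP// cumulS.
rewrite /mass big_cons -/(mass y).
have [l0 l1] := lower_bounds y.
case: (boolP (cumul j <= u < cumul j + q j)) => uj /=.
  have qj : 0 < q j.
    by have /andP[h1 h2] := uj; rewrite -(ltrD2l (cumul j)) addr0 (le_lt_trans h1).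
  have /eqP dj : digit u == j by rewrite digitP// cumulS.
  rewrite IH; last first.
    by rewrite /shift dj divr_ge0 ?subr_ge0//= ?ltr_pdivrMr// ?mul1r ?ltrBlDl//;
      case/andP: uj.
  rewrite /shift dj ler_pdivlMr// ltr_pdivrMr// lerBrDl ltrBlDl.
  by rewrite [lower y * _]mulrC [(lower y + _) * _]mulrC mulrDr addrA.
symmetry; apply: contraNF uj => /andP[h1 h2]; apply/andP; split.
  by apply: le_trans h1; rewrite lerDl mulr_ge0.
apply: lt_le_trans h2 _; rewrite -addrA -mulrDr lerD2l.
by rewrite ler_piMr.
Qed.

Lemma wordS n u : word n.+1 u = rcons (word n u) (digit (iter n shift u)).
Proof. by rewrite /word trajectSr map_rcons. Qed.

Definition word_event (y : seq 'I_m.+1) (n : nat) (A : pred (seq 'I_m.+1)) :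
    set (measurableTypeR R) :=
  [set u | [/\ 0 <= u < 1, word (size y) u = y & A (word (size y + n) u)]].

(** Induction on the number of free digits, splitting on the next one; with none left the event is
    empty or the interval of [wordP]. *)
Lemma word_event_probability y n (A : pred (seq 'I_m.+1)) :
  measurable (word_event y n A) /\
  unit_probability (word_event y n A) =
    (mass y * column_mean q n (fun z => (A (y ++ z))%:R))%:E.
Proof.
elim: n y => [|n IH] y.
  rewrite /= cats0.
  have -> : word_event y 0 A = if A y then `[lower y, lower y + mass y[%classic else set0.
    apply/seteqP; split => u /=.
      move=> [u01 uy]; rewrite addn0 uy => ->.
      by rewrite /= in_itv /= -wordP// uy.
    case: ifP => //= Ay; rewrite in_itv /= => uy.
    have [l0 l1] := lower_bounds y.
    have u01 : 0 <= u < 1.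
      by case/andP: uy => h1 h2; rewrite (le_trans l0 h1) (lt_le_trans h2).
    have /eqP uE : word (size y) u == y by rewrite wordP.
    by split; rewrite // addn0 uE.
  case: ifP => _; last by split => //; rewrite measure0 mulr0.
  split; first exact: measurable_itv.
  rewrite mulr1 /unit_probability /mrestr.
  have -> : `[lower y, lower y + mass y[%classic `&` unit_itv = `[lower y, lower y + mass y[%classic.
    apply/setIidPl => u; rewrite /unit_itv /= !in_itv /= => /andP[h1 h2].
    have [l0 l1] := lower_bounds y.
    by rewrite (le_trans l0 h1) (lt_le_trans h2).
  rewrite lebesgue_measure_itv /= lte_fin ltrDl.
  have m0 : 0 <= mass y by exact: prodr_ge0.
  case: ifPn => [_|]; first by rewrite -EFinD addrAC subrr add0r.
  by rewrite -leNgt => m0'; congr (_%:E); apply/le_anti; rewrite m0 m0'.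
have E : word_event y n.+1 A =
    \bigcup_(j in [set` index_enum 'I_m.+1]) word_event (rcons y j) n A.
  apply/seteqP; split => u /=.
    move=> [u01 uy uA]; exists (digit (iter (size y) shift u)).
      by rewrite /= mem_index_enum.
    split => //; first by rewrite size_rcons wordS uy.
    by rewrite size_rcons addSnnS.
  move=> [j _ [u01 uy uA]]; split => //.
    by move: uy; rewrite size_rcons wordS => /rcons_inj[].
  by move: uA; rewrite size_rcons addSnnS.
have mE j : measurable (word_event (rcons y j) n A) by have [] := IH (rcons y j).
split; first by rewrite E; apply: fin_bigcup_measurable.
rewrite E measure_fin_bigcup//; last first.
  apply/trivIsetP => i j _ _ ij; apply/seteqP; split => // u [[_ ui _] [_ uj _]].
  move: ui uj; rewrite !size_rcons => -> /rcons_inj[] eij.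
  by rewrite eij eqxx in ij.
rewrite -fsbig_seq ?index_enum_uniq// [RHS]/= mulr_sumr -sumEFin.
apply: eq_bigr => j _; have [_ IHj] := IH (rcons y j); apply: (etrans IHj).
rewrite /mass big_rcons /= mulrCA mulrA [q j * _]mulrC; congr (_ * _)%:E.
by apply: eq_column_mean => z; rewrite cat_rcons.
Qed.

Lemma column_mean_prod n (g : nat -> 'I_m.+1 -> R) :
  column_mean q n (fun y => \prod_(k < n) g k (nth ord0 y k)) =
  \prod_(k < n) \sum_j q j * g k j.
Proof.
elim: n g => [|n IH] g; first by rewrite /= !big_ord0.
rewrite big_ord_recl /= mulr_suml; apply: eq_bigr => j _.
rewrite -mulrA; congr (_ * _).
rewrite -(IH (fun k => g k.+1)).
have Z c H : column_mean q n (fun y => c * H y) = c * column_mean q n H.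
  elim: {IH} n H => //= n IH H; rewrite mulr_sumr; apply: eq_bigr => i _.
  by rewrite IH mulrCA.
by rewrite -Z; apply: eq_column_mean => y; rewrite big_ord_recl.
Qed.

Variable a : 'I_m.+1 -> \bar R.

(** Distinct edges read distinct digits of the same point. *)
Definition edge_code (e : nat * nat) : nat := choice.pickle e.

Lemma edge_code_inj : injective edge_code.
Proof. exact: (pcan_inj choice.pickleK). Qed.

(** The second branch is a default on the complement of [[0, 1[], which is a null set. *)
Definition digit_weight (e : nat * nat) (u : measurableTypeR R) : \bar R :=
  if 0 <= u < 1 then a (digit (iter (edge_code e) shift u)) else a ord0.

Lemma nth_word n k u : (k < n)%N -> nth ord0 (word n u) k = digit (iter k shift u).
Proof. by move=> kn; rewrite (nth_map u) ?size_traject// nth_traject. Qed.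

Lemma digit_weights_event (s : seq (nat * nat)) (B : nat * nat -> set (\bar R)) n :
  (forall e, e \in s -> (edge_code e < n)%N) ->
  (\bigcap_(e in [set` s]) (digit_weight e @^-1` B e)) `&` unit_itv =
  word_event [::] n
    (fun y => all (fun e => `[< B e (a (nth ord0 y (edge_code e))) >]) s).
Proof.
move=> sn; apply/seteqP; split => u /=.
  rewrite /unit_itv /= in_itv /= => -[uB u01]; split => //.
  apply/allP => e es; apply/asboolP; rewrite nth_word ?sn//.
  by have := uB e es; rewrite /digit_weight /= u01.
move=> [u01 _ /allP uB]; split; last by rewrite /unit_itv /= in_itv.
move=> e es; rewrite /digit_weight /= u01.
by have /asboolP := uB e es; rewrite nth_word ?sn.
Qed.

Lemma measurable_digit_weight e : measurable_fun [set: measurableTypeR R] (digit_weight e).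
Proof.
move=> _ B mB; rewrite setTI.
have -> : digit_weight e @^-1` B =
    (digit_weight e @^-1` B `&` unit_itv) `|` (digit_weight e @^-1` B `\` unit_itv).
  by rewrite setUIDK.
apply: measurableU.
  have := @digit_weights_event [:: e] (fun=> B) (edge_code e).+1.
  rewrite set_cons1 bigcap_set1 => ->; first by have [] := word_event_probability [::] (edge_code e).+1
    (fun y => all (fun e => `[< B (a (nth ord0 y (edge_code e))) >]) [:: e]).
  by move=> e'; rewrite inE => /eqP ->.
have [aB|aB] := pselect (B (a ord0)).
  have -> : digit_weight e @^-1` B `\` unit_itv = ~` unit_itv.
    apply/seteqP; split => [u [_ nu]|u nu]; first exact: nu.
  split; last exact: nu.
  by rewrite /= /digit_weight; case: ifPn.
  by apply: measurableC; exact: (@measurable_unit_itv R).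
suff -> : digit_weight e @^-1` B `\` unit_itv = set0 by exact: measurable0.
apply/seteqP; split => // u [/= uB nu]; move: uB; rewrite /digit_weight.
by case: ifPn.
Qed.

HB.instance Definition _ e := isMeasurableFun.Build _ _ _ _ (digit_weight e)
  (measurable_digit_weight e).

Lemma prod_seq_by_code (s : seq (nat * nat)) n (G : nat * nat -> R) :
  (forall e, e \in s -> (edge_code e < n)%N) ->
  \prod_(e <- s) G e = \prod_(k < n) \prod_(e <- s | edge_code e == k) G e.
Proof.
move=> sn; under [RHS]eq_bigr do rewrite big_mkcond.
rewrite exchange_big /= big_seq [RHS]big_seq; apply: eq_bigr => e es.
by rewrite -big_mkcond /= (big_pred1 (Ordinal (sn e es))).
Qed.

(** Only the first [n] digits are involved; positions that no edge of [s] reads contribute a factor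
    1. *)
Lemma digit_weights_probability (s : seq (nat * nat)) (B : nat * nat -> set (\bar R)) :
  uniq s -> unit_probability (\bigcap_(e in [set` s]) (digit_weight e @^-1` B e)) =
  (\prod_(e <- s) \sum_j q j * (a j \in B e)%:R)%:E.
Proof.
move=> us; pose n := (\max_(e <- s) edge_code e).+1.
have sn e : e \in s -> (edge_code e < n)%N.
  by move=> es; rewrite ltnS (@leq_bigmax_seq _ _ xpredT (fun e => edge_code e)).
have -> A : unit_probability A = unit_probability (A `&` unit_itv).
  by rewrite /unit_probability /mrestr -setIA setIid.
rewrite (digit_weights_event B sn); have [_ ->] := word_event_probability [::] n
    (fun y => all (fun e => `[< B e (a (nth ord0 y (edge_code e))) >]) s).
rewrite /mass big_nil mul1r; congr (_%:E).
have allE y : (all (fun e => `[< B e (a (nth ord0 y (edge_code e))) >]) s)%:R =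
    \prod_(e <- s) (a (nth ord0 y (edge_code e)) \in B e)%:R :> R.
  elim: {us sn n} s => [|e s IH] /=; first by rewrite big_nil.
  by rewrite big_cons -IH -mulnb natrM.
pose g k j := \prod_(e <- s | edge_code e == k) (a j \in B e)%:R : R.
transitivity (column_mean q n (fun y => \prod_(k < n) g k (nth ord0 y k))).
  apply: eq_column_mean => y /=.
  rewrite allE (prod_seq_by_code _ sn); apply: eq_bigr => k _.
  by apply: eq_bigr => e /eqP ->.
rewrite column_mean_prod (prod_seq_by_code _ sn); apply: eq_bigr => k _.
rewrite /g; case: (boolP (has (fun e => edge_code e == k) s)) => [/hasP[e es /eqP ek]|nk].
  have pk e' : (edge_code e' == k) = (e' == e) by rewrite -ek (inj_eq edge_code_inj).
  rewrite (eq_bigl (pred1 e))// -big_filter filter_pred1_uniq// big_seq1.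
  apply: eq_bigr => j _; rewrite (eq_bigl (pred1 e))//.
  by rewrite -big_filter filter_pred1_uniq// big_seq1.
have pk (F : nat * nat -> R) : \prod_(e <- s | edge_code e == k) F e = 1.
  by rewrite -big_filter (eqP (_ : [seq e <- s | edge_code e == k] == [::])) ?big_nil//
    -size_eq0 size_filter -leqn0 leqNgt -has_count.
by rewrite pk; under eq_bigr do rewrite pk mulr1.
Qed.

Lemma digit_weights_iid (nu : set (\bar R) -> \bar R) :
  (forall A, nu A = (\sum_j (q j)%:E * \d_(a j) A)%E) ->
  @iid_weights R _ _ unit_probability nu digit_weight.
Proof.
move=> nuE; split.
  move=> s B _ _; apply: (etrans (digit_weights_probability B (fset_uniq s))).
  rewrite -prodEFin; apply: eq_bigr => e _.
  have := @digit_weights_probability [:: e] B isT.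
  by rewrite set_cons1 bigcap_set1 big_seq1 => /esym.
move=> e _ A mA; rewrite /distribution /pushforward.
have := @digit_weights_probability [:: e] (fun=> A) isT.
rewrite set_cons1 bigcap_set1 big_seq1 => h; apply: (etrans h).
by rewrite nuE -sumEFin; apply: eq_bigr => j _; rewrite diracE EFinM.
Qed.

End Digits.

(** * The time constant *)

Section TimeConstants.
Context {R : realType} {m : nat}.
Variables (a : 'I_m.+1 -> \bar R) (q : 'I_m.+1 -> R) (nu : set (\bar R) -> \bar R).
Hypotheses (a_inj : injective a) (q_ge0 : forall i, 0 <= q i) (q_sum1 : \sum_i q i = 1).
Hypothesis nuE : forall A, nu A = (\sum_i (q i)%:E * \d_(a i) A)%E.
Hypothesis a_lty : forall j, (a j < +oo)%E.
Hypothesis q0_gt0 : 0 < q ord0.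

(** [is_time_constant] quantifies over all families of weights, so uniqueness requires that one
    exist: the digits provide it. Both limits then hold at a common point. *)
Lemma time_constantE c : is_time_constant nu c -> time_constant nu = c.
Proof.
move=> tc; rewrite /time_constant; apply: xget_unique => // c' tc'.
have iid := digit_weights_iid q_ge0 q_sum1 nuE.
have h1 := tc _ _ _ _ iid; have h2 := tc' _ _ _ _ iid.
have P1 : (0 < unit_probability [set: measurableTypeR R])%E.
  by rewrite probability_setT.
have FF := ae_properfilter_algebraOfSetsType P1.
have [w [w1 w2]] := @filter_ex _ _ FF _ (filterI h2 h1).
exact: cvg_unique w1 w2.
Qed.

Lemma ninfty_time_constant : a ord0 = -oo%E -> (forall j, (a j <= a ord0)%E) ->
  is_time_constant nu -oo%E.
Proof.
move=> a0 aj d T P X iid; apply: filterS (ae_realizes nuE iid) => w [x wx].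
apply: cvg_near_cst; exists 1%N => // n n1.
have -> : last_passage (fun e => X e w) n = -oo%E.
  apply/eqP; rewrite -leeNy_eq; apply: ge_ereal_sup => _ [[|k s] [ps lasts] <-].
    by move: n1; rewrite -lasts.
  move: ps => /= /andP[ks _].
  rewrite path_weight_cons wx// (_ : a _ = -oo%E) ?addNye//.
  by apply/eqP; rewrite -leeNy_eq -a0.
by rewrite gt0_mulNye// lte_fin invr_gt0 ltr0n.
Qed.

Variable alpha : R.
Hypothesis a0E : a ord0 = alpha%:E.
Hypothesis a_le : forall j, (a j <= alpha%:E)%E.

Lemma nonpos_time_constant : alpha <= 0 -> is_time_constant nu 0%E.
Proof.
move=> alpha0 d T P X iid.
have h1 := ae_realizes nuE iid.
have h2 := ae_connected a_inj q_ge0 nuE iid q_sum1 q0_gt0 (isT : (0 < 2)%N).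
apply: filterS2 h1 h2 => w [x wx] [n0 hn0].
have XE i k : (i < k)%N -> X (i, k) w = a (x (i, k)) by move=> ik; exact: wx.
(* The sandwich is used with [- alpha] for [alpha]: a two-edge path has weight [2 * alpha], at least
   [2 * (n %/ k) * alpha] once [n >= k]. *)
apply: (@cvg_last_passage _ _ (fun=> 0) 0 (- alpha)).
- by rewrite oppr_ge0.
- by under eq_fun do rewrite mul0r; exact: cvg_cst.
move=> k k1; exists (maxn n0 k) => n; rewrite geq_max => /andP[n0n kn].
apply/andP; split; last exact: (last_passage_nonpos a_le XE _ alpha0).
apply: le_trans (last_passage_ge2 XE a0E (hn0 n n0n x wx 0%N _)); last by [].
have nk : (n %/ k)%:R * alpha <= alpha.
  rewrite -[leRHS]mul1r ler_wnM2r// -[1](natrX R 1 1) ler_nat.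
  by rewrite expn1 divn_gt0// (leq_trans _ k1).
by rewrite lee_fin; lra.
Qed.

Variable B : R.
Hypothesis alpha_gt0 : 0 < alpha.
Hypothesis osc : forall K n s s', (n <= K)%N -> is_config s -> is_config s' ->
  `|(chain_mean a q K n s front - front s) -
    (chain_mean a q K n s' front - front s')| <= B.

(** Concentration along squares and interpolation treat the top values; two-edge connections with
    [g = n %/ k] then bring in [last_passage]. *)
Lemma positive_time_constant C :
  mean_top a q n / n%:R @[n --> \oo] --> C -> is_time_constant nu C%:E.
Proof.
move=> meanC d T P X iid.
have alpha0 := ltW alpha_gt0.
have h1 := ae_realizes nuE iid.
have h2 k := ae_connected a_inj q_ge0 nuE iid q_sum1 q0_gt0 (ltn0Sn k).
have h3 k := ae_top_concentrated a_inj q_ge0 nuE iid q_sum1 a0E a_le alpha_gt0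
  osc (ltn0Sn k).
have h2' := ae_foralln h2; have h3' := ae_foralln h3.
apply: filterS3 h1 h2' h3' => w [x wx] conn conc.
have XE i k : (i < k)%N -> X (i, k) w = a (x (i, k)) by move=> ik; exact: wx.
apply: (@cvg_last_passage _ _ (top_value a x) C alpha) => //.
  apply: (@cvg_of_squares _ _ (mean_top a q)) => //.
  - exact: top_value_homo.
  - case=> // k _; have [n0 hn0] := conc k; exists n0 => n n0n.
    exact: hn0.
case=> // k k1.
(* The first threshold serves to connect 0 to every large vertex, the second to connect the vertices
   up to [n - n %/ k.+1] to [n]. *)
have [n0 hn0] := conn 1%N; have [n1 hn1] := conn k.
exists (maxn n1 (k.+1 * n0.+1)) => n; rewrite geq_max => /andP[n1n kn].
apply/andP; split; last exact: (last_passage_le XE a_lty).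
have g0 : (n0.+1 <= n %/ k.+1)%N by rewrite leq_divRL// mulnC.
apply: (last_passage_ge a_le XE a0E) => //.
- by rewrite (leq_trans _ g0)//= leq_div.
- move=> i /andP[gi iN]; apply: (hn0 i _ x wx) => //.
  by rewrite (leq_trans _ gi)// ltnW.
- by move=> i ing; exact: (hn1 n n1n x wx).
Qed.

End TimeConstants.

(** * From mean increments to power series *)

Section Analyticity.
Context {R : realType} {m : nat}.

Lemma analytic_on_of_poly_bounded (D : set 'rV[R]_m) (F : 'rV[R]_m -> \bar R) :
  (forall x, D x -> exists (r A rho : R) (f : nat -> 'rV[R]_m -> R),
    [/\ 0 < r, 0 <= A, 0 <= rho < 1,
        forall n, poly_bounded r (f n) (A * rho ^+ n) &
        forall (h : 'rV[R]_m) (l : R), (forall i, `|h ord0 i| <= r) -> D (x + h) ->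
          series (f^~ h) @ \oo --> l -> F (x + h) = l%:E]) ->
  analytic_on D F.
Proof.
move=> DF x /DF[r [A [rho [f [r0 A0 rho01 fB FE]]]]].
have [c hc] := power_series_of_poly_bounded r0 A0 rho01 fB.
exists c; apply/nbhs_ballP; exists r => //= y xy.
have hr i : `|(y - x) ord0 i| <= r.
  by have [_ /(_ ord0 i)] := xy; rewrite /ball /= !mxE distrC => /ltW.
have [l cl fl] := hc _ hr; exists l => // Dy.
by rewrite -(subrKC x y); apply: FE => //; rewrite subrKC.
Qed.

(** The masses are affine in [p] and sum to 1 also outside the simplex. *)
Definition law_weight (p : 'rV[R]_m) (i : 'I_m.+1) : R :=
  if unlift ord0 i is Some j then p ord0 j else 1 - \sum_j p ord0 j.

Lemma law_weight0 p : law_weight p ord0 = 1 - \sum_j p ord0 j.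
Proof. by rewrite /law_weight unlift_none. Qed.

Lemma law_weight_lift p j : law_weight p (lift ord0 j) = p ord0 j.
Proof. by rewrite /law_weight liftK. Qed.

Lemma law_weight_sum p : \sum_i law_weight p i = 1.
Proof.
rewrite big_ord_recl law_weight0 -[RHS](subrK (\sum_j p ord0 j)); congr (_ + _).
by apply: eq_bigr => j _; rewrite law_weight_lift.
Qed.

Lemma atomic_lawE (a : 'I_m.+1 -> \bar R) p A :
  atomic_law a p A = (\sum_i (law_weight p i)%:E * \d_(a i) A)%E.
Proof.
rewrite /atomic_law big_ord_recl law_weight0; congr (_ + _)%E.
by apply: eq_bigr => j _; rewrite law_weight_lift.
Qed.

Lemma law_weight_ge0 p i : subsimplex p -> 0 <= law_weight p i.
Proof.
move=> [p01 /andP[_ p1]]; rewrite /law_weight; case: unlift => [j|].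
  by have /andP[] := p01 j.
by rewrite subr_ge0 ltW.
Qed.

Lemma law_weight0_gt0 p : subsimplex p -> 0 < law_weight p ord0.
Proof. by move=> [_ /andP[_ p1]]; rewrite law_weight0 subr_gt0. Qed.

Lemma poly_bounded_law_weight x r i : 0 <= r -> subsimplex x ->
  poly_bounded r (fun h => law_weight (x + h) i)
    (law_weight x i + (if i == ord0 then m%:R * r else r)).
Proof.
move=> r0 Dx; have wx := law_weight_ge0 i Dx.
have coord j : poly_bounded r (fun h : 'rV[R]_m => (x + h) ord0 j) (x ord0 j + r).
  have -> : (fun h : 'rV[R]_m => (x + h) ord0 j) = (fun h => x ord0 j + h ord0 j).
    by apply/funext => h; rewrite mxE.
  apply: poly_boundedD; last exact: poly_bounded_coord.
  have [/(_ j)/andP[x0 _] _] := Dx.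
  by have := @poly_bounded_cst R m r (x ord0 j); rewrite ger0_norm.
case: (unliftP ord0 i) wx => [j ->|->] wx.
  rewrite law_weight_lift eq_sym (negbTE (neq_lift _ _)).
  by under eq_fun do rewrite law_weight_lift.
rewrite eqxx.
have -> : (fun h => law_weight (x + h) ord0) =
    (fun h : 'rV[R]_m => law_weight x ord0 - \sum_j h ord0 j).
  apply/funext => h; rewrite !law_weight0 -addrA -opprD -big_split /=.
  by congr (_ - _); apply: eq_bigr => j _; rewrite mxE.
apply: poly_boundedB => //.
  by have := @poly_bounded_cst R m r (law_weight x ord0); rewrite ger0_norm.
have h_bounded j : poly_bounded r (fun h : 'rV[R]_m => h ord0 j) r.
  exact: poly_bounded_coord.
have := poly_bounded_sum (index_enum 'I_m) h_bounded.
by rewrite sumr_const card_ord mulr_natl.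
Qed.

Variables (a : 'I_m.+1 -> \bar R) (alpha : R).
Hypotheses (a0E : a ord0 = alpha%:E) (alpha_gt0 : 0 < alpha).
Hypothesis a_le : forall j, (a j <= alpha%:E)%E.

(** Both sides are the mean of the same top value over the weights of [n] columns. *)
Lemma chain_mean_truncation (q : 'I_m.+1 -> R) K n : \sum_i q i = 1 -> (n <= K)%N ->
  chain_mean a q K n [:: 0] front = mean_top a q n.
Proof.
move=> q1 nK; rewrite /mean_top.
have E k : (n <= k)%N -> chain_mean a q k n [:: 0] front =
    edge_mean q (columns 0 n) (fun x => front (ranked_values a x (0 + n))) (fun=> ord0).
  by move=> nk; rewrite (@edge_mean_columns _ _ a alpha q a0E alpha_gt0 a_le q1 k 0 n front).
by rewrite !E.
Qed.

(* Differences of the increments of mean_top: their series telescopes to the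
   increments, hence to the time constant. *)
Definition mean_top_term (q : 'I_m.+1 -> R) (n : nat) : R :=
  if n is n'.+1 then
    drift a q n'.+3 n'.+1 [:: 0] - drift a q n'.+3 n' [:: 0]
  else drift a q 1 0 [:: 0].

Lemma series_mean_top_term (q : 'I_m.+1 -> R) n : \sum_i q i = 1 ->
  series (mean_top_term q) n.+1 = mean_top a q n.+1 - mean_top a q n.
Proof.
move=> q1; elim: n => [|n IH].
  by rewrite /series /= big_nat1 /mean_top_term /drift !chain_mean_truncation.
have [n0 n1] : (n <= n.+3)%N /\ (n.+1 <= n.+3)%N.
  by split; [exact: (leq_addl 3 n)|exact: (leq_addl 2 n.+1)].
rewrite seriesSr IH /mean_top_term /drift !chain_mean_truncation//.
by rewrite addrC subrK.
Qed.

(** The increments of [mean_top] converge to [l], hence so do their Cesaro means. *)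
Lemma mean_top_cvg (q : 'I_m.+1 -> R) (l : R) :
  \sum_i q i = 1 -> series (mean_top_term q) @ \oo --> l ->
  mean_top a q n / n%:R @[n --> \oo] --> l.
Proof.
move=> q1 ql; rewrite -cvg_shiftS.
have E : (fun n => series (mean_top_term q) n.+1) =
    (fun n => mean_top a q n.+1 - mean_top a q n).
  by apply/funext => n; exact: series_mean_top_term.
have : series (mean_top_term q) n.+1 @[n --> \oo] --> l by rewrite cvg_shiftS.
rewrite E => /cesaro.
apply: cvg_trans; apply: near_eq_cvg; apply: nearW => n.
rewrite /arithmetic_mean /= mulrC; congr (_ * _); rewrite /series /=.
by rewrite telescope_sumr// /mean_top /= subr0.
Qed.

Lemma mean_top_term_bounded (M : nat) (r rho lam : R) (p : 'I_m.+1 -> 'rV[R]_M -> R)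
    (b : 'I_m.+1 -> R) (phi : nat -> R) :
  0 <= r -> (forall i, poly_bounded r (p i) (b i)) ->
  (forall h, \sum_i p i h = 1) -> phi 0%N = 1 -> (forall i, 0 <= phi i) -> 0 <= rho ->
  (forall K i, (i < K)%N -> letter_mean b K (fun y => phi (renew i y)) <= rho * phi i) ->
  (forall K, letter_mean b K (fun=> 1) <= lam) ->
  forall n, poly_bounded r (fun h => mean_top_term (p^~ h) n) (lam * alpha * rho ^+ n).
Proof.
move=> r0 pb p1 phi0 phi_ge0 rho0 phib lamb.
have cs0 : is_config [:: 0 : R] by rewrite /is_config /= lexx.
case=> [|n]; rewrite /mean_top_term.
  have -> : (fun h => drift a (p^~ h) 1 0 [:: 0]) = (fun h => letter_mean (p^~ h) 1
      (fun y => front (step a [:: 0] y) - front [:: 0])).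
    by apply/funext => h; rewrite drift0.
  apply: (@poly_bounded_le _ _ _ _ (letter_mean b 1 (fun=> alpha * 1))); last first.
    by rewrite letter_meanZ expr0 mulr1 mulrC ler_wpM2r// ltW.
  apply: (@poly_bounded_letter_mean _ _ _ r0 _ _ _ _
    (fun y _ => front (step a [:: 0] y) - front [:: 0])) => // y.
  apply: poly_bounded_le (poly_bounded_cst _ _) _.
  have /andP[h1 h2] := front_step_bounds alpha_gt0 a_le y cs0.
  by rewrite ger0_norm// mulr1.
have nn : (n.+1 < n.+3)%N by [].
have hd := drift_increment a0E alpha_gt0 a_le r0 pb p1 phi0
  phi_ge0 rho0 phib cs0 nn.
apply: (poly_bounded_le hd).
by rewrite ler_wpM2r ?exprn_ge0// ler_wpM2r// ltW.
Qed.

(** The geometric bounds of [drift_coupling], started at rank 0, are summed over the steps. *)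
Lemma chain_mean_osc (M : nat) (r rho : R) (p : 'I_m.+1 -> 'rV[R]_M -> R)
    (b : 'I_m.+1 -> R) (phi : nat -> R) (h : 'rV[R]_M) :
  0 <= r -> (forall i, poly_bounded r (p i) (b i)) ->
  (forall h, \sum_i p i h = 1) -> phi 0%N = 1 -> (forall i, 0 <= phi i) -> 0 <= rho < 1 ->
  (forall K i, (i < K)%N -> letter_mean b K (fun y => phi (renew i y)) <= rho * phi i) ->
  (forall i, `|h ord0 i| <= r) ->
  forall K n s s', (n <= K)%N -> is_config s -> is_config s' ->
  `|(chain_mean a (p^~ h) K n s front - front s) -
    (chain_mean a (p^~ h) K n s' front - front s')| <= alpha * rho / (1 - rho).
Proof.
move=> r0 pb p1 phi0 phi_ge0 rho01 phib hr K n s s' nK cs cs'.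
have /andP[rho0 rho1] := rho01.
rewrite !chain_mean_front -sumrB; apply: le_trans (ler_norm_sum _ _ _) _.
have ar0 : 0 <= alpha * rho by rewrite mulr_ge0// ltW.
have := geometric_tail_le 0 n ar0 rho01; rewrite expr0 mulr1; apply: le_trans.
rewrite big_mkord; apply: ler_sum => i _.
have iK : (0 + i < K)%N by exact: leq_trans (ltn_ord i) nK.
have := drift_coupling a0E alpha_gt0 a_le r0 pb p1 phi0 phi_ge0 rho0 phib cs cs'
  (agree0 s s') iK.
move=> /(poly_bounded_norm r0)/(_ hr); rewrite phi0 mulr1 exprS mulrA.
exact.
Qed.

End Analyticity.

(** * The two signs of the largest weight *)

Section Domain.
Context {R : realType} {m : nat}.
Variable a : 'I_m.+1 -> \bar R.
Hypothesis a_lty : forall i, (a i < +oo)%E.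
Hypothesis a_decr : forall i j : 'I_m.+1, (i < j)%N -> (a j < a i)%E.

Lemma decreasing_inj : injective a.
Proof.
move=> i j aij; apply/val_inj; case: (ltngtP i j) => // /a_decr.
  by rewrite aij ltxx.
by rewrite aij ltxx.
Qed.

Lemma decreasing_le0 j : (a j <= a ord0)%E.
Proof.
case: (posnP j) => [j0|j0]; last exact/ltW/a_decr.
by rewrite (_ : j = ord0)//; apply/val_inj.
Qed.

Variable alpha : R.
Hypothesis a0E : a ord0 = alpha%:E.

Let a_le j : (a j <= alpha%:E)%E.
Proof. by rewrite -a0E decreasing_le0. Qed.

Let timeE p c : subsimplex p -> is_time_constant (atomic_law a p) c ->
  time_constant (atomic_law a p) = c.
Proof.
move=> Dp; apply: (time_constantE _ (law_weight_sum p) (atomic_lawE a p)) => i.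
exact: law_weight_ge0.
Qed.

Lemma analytic_nonpos : alpha <= 0 ->
  analytic_on (@subsimplex R m) (fun p => time_constant (atomic_law a p)).
Proof.
move=> alpha0; apply: analytic_on_of_poly_bounded => x Dx.
exists 1, 0, 0, (fun _ _ => 0); split => //.
- by rewrite lexx ltr01.
- by move=> n; have := @poly_bounded_cst R m 1 0; rewrite normr0 mul0r.
move=> h l _ Dh sl.
have -> : l = 0.
  apply: (cvg_unique _ sl) => //; rewrite /series /=.
  by under eq_fun do rewrite big1//; exact: cvg_cst.
apply: timeE => //.
apply: (nonpos_time_constant decreasing_inj _ (law_weight_sum (x + h))
  (atomic_lawE a (x + h)) _ a0E a_le alpha0).
- by move=> i; exact: law_weight_ge0.
- exact: law_weight0_gt0.
Qed.

Lemma analytic_pos : 0 < alpha ->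
  analytic_on (@subsimplex R m) (fun p => time_constant (atomic_law a p)).
Proof.
move=> alpha0; apply: analytic_on_of_poly_bounded => x Dx.
pose P := law_weight x ord0.
have P0 : 0 < P by exact: law_weight0_gt0.
have P1 : P <= 1.
  by rewrite /P law_weight0 gerBl; have [_ /andP[]] := Dx.
(* The other masses sum to [1 - P] at [x]; the bound [1 - P / 2] leaves their majorants room to
   grow. *)
have Qb0 : 0 <= 1 - P / 2 by lra.
have Qb1 : 1 - P / 2 < 1 by lra.
have [phi [rho [delta [rho01 delta0 phi0 phi01 phiP]]]] :=
  drift_function m P0 P1 Qb0 Qb1.
(* The first bound keeps the majorants of the other masses below [1 - P / 2] in sum; together the
   two keep [lam] below [1 + delta]. *)
pose e := Num.min (P / 2) (delta * P / 4).
have e0 : 0 < e by rewrite lt_min !divr_gt0// mulr_gt0.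
(* With [m.+1] the radius is positive also for [m = 0]. *)
pose r := e / m.+1%:R.
have r0 : 0 < r by rewrite divr_gt0.
have mr : m%:R * r <= e.
  rewrite /r mulrCA ler_piMr ?(ltW e0)// ler_pdivrMr// mul1r ler_nat.
  exact: leqnSn.
have mr0 : 0 <= m%:R * r by rewrite mulr_ge0// ltW.
have mr1 : m%:R * r <= P / 2 by apply: le_trans mr _; rewrite ge_min lexx.
have mr2 : m%:R * r <= delta * P / 4.
  by apply: le_trans mr _; rewrite ge_min lexx orbT.
pose b (i : 'I_m.+1) := law_weight x i + (if i == ord0 then m%:R * r else r).
pose p i (h : 'rV[R]_m) := law_weight (x + h) i.
have pb i : poly_bounded r (p i) (b i).
  by apply: poly_bounded_law_weight => //; exact: ltW.
have p1 h : \sum_i p i h = 1 by exact: law_weight_sum.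
have b0 i : 0 <= b i.
  by rewrite addr_ge0 ?law_weight_ge0//; case: ifP => // _; exact: ltW.
have bP : b ord0 = P + m%:R * r by rewrite /b eqxx.
have bQ : \sum_(j < m) b (lift ord0 j) = 1 - P + m%:R * r.
  transitivity (\sum_(j < m) (x ord0 j + r)).
    by apply: eq_bigr => j _; rewrite /b eq_sym (negbTE (neq_lift _ _)) law_weight_lift.
  rewrite big_split /= sumr_const card_ord mulr_natl /P law_weight0.
  by rewrite subKr.
(* The fixed point of [u -> b ord0 + Q * u], where [Q] is the sum of the other majorants and
   [1 - Q = P - m%:R * r]. *)
pose lam := (P + m%:R * r) / (P - m%:R * r).
have PR : 0 < P - m%:R * r by lra.
have lam1 : 1 <= lam by rewrite ler_pdivlMr// mul1r; lra.
have lamd : lam <= 1 + delta.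
  rewrite ler_pdivrMr//.
  have : delta * (m%:R * r) <= delta * (P / 2) by rewrite ler_wpM2l// ltW.
  by lra.
have lamfix : b ord0 + (\sum_(j < m) b (lift ord0 j)) * lam <= lam.
  rewrite bQ bP; have : lam * (P - m%:R * r) = P + m%:R * r by rewrite divfK// gt_eqF.
  by lra.
have phib K i : (i < K)%N -> letter_mean b K (fun y => phi (renew i y)) <= rho * phi i.
  apply: (phiP b lam) => //; first by rewrite bP lerDl.
  by rewrite bQ; lra.
have lamb K : letter_mean b K (fun=> 1) <= lam by exact: letter_mean1_le.
have /andP[rho0 rho1] := rho01.
have rho01' : 0 <= rho < 1 by rewrite (ltW rho0).
have phi_ge0 i : 0 <= phi i by have /andP[] := phi01 i.
have r_ge0 := ltW r0.
exists r, (lam * alpha), rho, (fun n h => mean_top_term a (p^~ h) n); split => //.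
- by rewrite mulr_ge0 ?(ltW alpha0)// (le_trans ler01).
- exact: (mean_top_term_bounded a0E alpha0 a_le r_ge0 pb p1 phi0 phi_ge0 (ltW rho0) phib lamb).
(* The norm bounds hold on the whole polydisc; the identification with the time constant takes
   [x + h] in the simplex, where the masses form a probability. *)
move=> h l hr Dh sl; apply: timeE => //.
apply: (positive_time_constant decreasing_inj _ (law_weight_sum (x + h))
  (atomic_lawE a (x + h)) a_lty _ a0E a_le alpha0
  (chain_mean_osc a0E alpha0 a_le r_ge0 pb p1 phi0 phi_ge0 rho01' phib hr)).
- by move=> i; exact: law_weight_ge0.
- exact: law_weight0_gt0.
- exact: (mean_top_cvg a0E alpha0 a_le (p1 h) sl).
Qed.

End Domain.

Local Open Scope ereal_scope.

(* The second conjunct is the degenerate case N = 1, a_1 = -oo, where the map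
   is the constant -oo on a one-point domain. *)
Theorem theorem1p7 (R : realType) (m : nat) (a : 'I_m.+1 -> \bar R)
    (a_lt_pinfty : forall i, a i < +oo)
    (a_decreasing : forall i j : 'I_m.+1, (i < j)%N -> a j < a i) :
  (a ord0 != -oo ->
    analytic_on (@subsimplex R m) (fun p => time_constant (atomic_law a p))) /\
  (a ord0 = -oo ->
    forall p, subsimplex p -> time_constant (atomic_law a p) = -oo).
Proof.
split=> [a0N|a0N p Dp].
  case a0E : (a ord0) (a_lt_pinfty ord0) a0N => [alpha| |] // _ _.
  case: (lerP alpha 0%R) => alpha0.
    exact: (analytic_nonpos a_decreasing a0E).
  exact: (analytic_pos a_lt_pinfty a_decreasing a0E).
apply: (time_constantE _ (law_weight_sum p) (atomic_lawE a p)).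
  by move=> i; exact: law_weight_ge0.
apply: (ninfty_time_constant (atomic_lawE a p)) => //.
exact: decreasing_le0.
Qed.
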